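(* Let $\Sigma$ be a ranked alphabet and $k\ge1$. A tree language $L\subseteq T_\Sigma$ is accepted by some deterministic $k$-head tree-walking automaton with nested pebbles if and only if $L=\{t\in T_\Sigma\mid t\models\phi\}$ for some closed formula $\phi$ of FO+DTC$^k$ over $\Sigma$. That is, $\mathrm{DPTWA}^k=\mathrm{FO{+}DTC}^k$.
   Context: Trees: a ranked alphabet is a finite set $\Sigma$ with a map $\mathrm{rank}:\Sigma\to\mathbb{N}$; $T_\Sigma$ is the set of trees over $\Sigma$, where a node labelled $\sigma$ has exactly $\mathrm{rank}(\sigma)$ children numbered $1,\dots,\mathrm{rank}(\sigma)$ (child number of the root is $0$). Strings are the special case of monadic trees. Logic: first-order logic over $\Sigma$ has node variables, atomic formulas $\mathrm{lab}_\sigma(x)$, $\mathrm{edg}_i(x,y)$ ($y$ is the $i$-th child of $x$), $x\le y$ ($x$ is an ancestor of $y$), $x=y$, and is closed under $\neg,\wedge,\vee,\exists,\forall$. $k$-ary transitive closure: for a formula $\phi$ with $k$-tuples $\bar x,\bar y$ of distinct free variables (other free variables fixed), $t\models\phi^*(\bar u,\bar v)$ iff there are $k$-tuples of nodes $\bar u_0=\bar u,\dots,\bar u_n=\bar v$ ($n\ge0$) with $t\models\phi(\bar u_i,\bar u_{i+1})$ for all $i<n$. It is deterministic if $\phi$ is functional: for every tree, every valuation of the other free variables and every $\bar u$ there is at most one $\bar v$ with $\phi(\bar u,\bar v)$. FO+DTC$^k$ is first-order logic extended with $k$-ary deterministic transitive closure. Automata: a $k$-head tree-walking automaton with nested pebbles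 is $\mathcal A=(Q,\Sigma,X,q_0,A,I)$: finite states $Q$, finite pebble set $X$, initial state $q_0$, accepting states $A$, finite set $I$ of instructions $\langle p,\chi,q\rangle$ with $\chi$ one of $\mathrm{up}_i$, $\mathrm{down}_{i,j}$, $\mathrm{drop}_i(x)$, $\mathrm{retrieve}(x)$, $\mathrm{lab}_{i,\sigma}$, $\mathrm{peb}_i(x)$, $\mathrm{chno}_{i,j}$ or a negated test $\neg\mathrm{lab}_{i,\sigma}$, $\neg\mathrm{peb}_i(x)$, $\neg\mathrm{chno}_{i,j}$ ($1\le i\le k$ a head, $x\in X$). Configurations: $[p,\bar u,\alpha]$ with state, $k$-tuple of head nodes, and stack $\alpha$ of (pebble,node) pairs. Semantics: $\mathrm{up}_i$/$\mathrm{down}_{i,j}$ move head $i$ to the parent/$j$-th child; $\mathrm{drop}_i(x)$ pushes $(x,u[i])$ if $x$ is not on the stack; $\mathrm{retrieve}(x)$ pops the top pair if its pebble is $x$, regardless of head positions; tests check the label of $u[i]$, the presence of $(x,u[i])$ on the stack, or the child number of $u[i]$ (negated tests succeed iff the test fails) and change nothing. A configuration is halting if no instruction applies. $t\in L(\mathcal A)$ iff from $[q_0,\overline{\mathrm{root}},\varepsilon]$ a halting configuration $[p,\overline{\mathrm{root}},\varepsilon]$ with $p\in A$ is reachable. $\mathcal A$ is deterministic if for any two distinct instructions from the same state, with tests/operations $\chi_1,\chi_2$, $\chi_1=\neg\chi_2$ or $\chi_2=\neg\chi_1$. *)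

(* Defs.v *)
From HB Require Import structures.
From Stdlib Require Import Relation_Operators.
From mathcomp Require Export all_boot.

Set Implicit Arguments.
Unset Strict Implicit.
Unset Printing Implicit Defensive.

Section Trees.
Variables (Sigma : finType) (rank : Sigma -> nat).

Inductive tree : Type :=
  TreeNode (s : Sigma) (c : {ffun 'I_(rank s) -> tree}).

(* Children are numbered from 1: [:: i1; ...; in] is the i_n-th child of ...
   of the i_1-th child of the root. *)
Fixpoint subtree_at (t : tree) (a : seq nat) {struct a} : option tree :=
  match a with
  | [::] => Some t
  | 0 :: _ => None
  | i.+1 :: a' =>
      let: TreeNode s c := t in
      match insub i : option 'I_(rank s) with
      | Some j => subtree_at (c j) a'
      | None => None
      end
  end.

Record node (t : tree) := Node { addr : seq nat; _ : isSome (subtree_at t addr) }.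

HB.instance Definition _ (t : tree) := [isSub for @addr t].
HB.instance Definition _ (t : tree) := [Equality of node t by <:].

Section NodeRelations.
Variable t : tree.

Definition tree_root : node t := @Node t [::] isT.

Definition has_label (s : Sigma) (x : node t) : Prop :=
  exists c, subtree_at t (addr x) = Some (@TreeNode s c).

Definition is_child (i : nat) (x y : node t) : bool :=
  addr y == rcons (addr x) i.

Definition ancestor (x y : node t) : bool := prefix (addr x) (addr y).

Definition child_number (x : node t) : nat := last 0 (addr x).

End NodeRelations.
End Trees.

Arguments tree_root {Sigma rank} t.

Section Logic.
Variables (Sigma : finType) (rank : Sigma -> nat) (k : nat).

(* FTC phi xs ys us vs is the formula phi^*(us, vs), the closure being taken
   with respect to the variables xs, ys of phi, which become bound. *)
Inductive formula : Type :=
  | FLab (s : Sigma) (x : nat)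
  | FEdg (i : nat) (x y : nat)
  | FLe (x y : nat)
  | FEq (x y : nat)
  | FNot (phi : formula)
  | FAnd (phi psi : formula)
  | FOr (phi psi : formula)
  | FEx (x : nat) (phi : formula)
  | FAll (x : nat) (phi : formula)
  | FTC (phi : formula) (xs ys us vs : k.-tuple nat).

Fixpoint free_vars (phi : formula) : seq nat :=
  match phi with
  | FLab _ x => [:: x]
  | FEdg _ x y | FLe x y | FEq x y => [:: x; y]
  | FNot phi => free_vars phi
  | FAnd phi psi | FOr phi psi => free_vars phi ++ free_vars psi
  | FEx x phi | FAll x phi => [seq z <- free_vars phi | z != x]
  | FTC phi xs ys us vs =>
      [seq z <- free_vars phi | z \notin xs ++ ys] ++ us ++ vs
  end.

Definition closed_formula (phi : formula) : bool := free_vars phi == [::].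

Definition valuation (t : tree rank) : Type := nat -> node t.

Definition update (t : tree rank) (v : valuation t) (x : nat) (u : node t)
    : valuation t :=
  fun z => if z == x then u else v z.

(* If z is not in xs, then index z xs = k is out of range for us, and the
   default v z is returned. *)
Definition update_tuple (t : tree rank) (v : valuation t)
    (xs : k.-tuple nat) (us : k.-tuple (node t)) : valuation t :=
  fun z => nth (v z) us (index z xs).

Fixpoint sat (t : tree rank) (v : valuation t) (phi : formula) : Prop :=
  match phi with
  | FLab s x => has_label s (v x)
  | FEdg i x y => is_child i (v x) (v y)
  | FLe x y => ancestor (v x) (v y)
  | FEq x y => v x = v y
  | FNot phi => ~ sat v phi
  | FAnd phi psi => sat v phi /\ sat v psi
  | FOr phi psi => sat v phi \/ sat v psi
  | FEx x phi => exists u, sat (update v x u) phi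
  | FAll x phi => forall u, sat (update v x u) phi
  | FTC phi xs ys us vs =>
      clos_refl_trans (k.-tuple (node t))
        (fun a b => sat (update_tuple (update_tuple v xs a) ys b) phi)
        (map_tuple v us) (map_tuple v vs)
  end.

Definition functional (phi : formula) (xs ys : k.-tuple nat) : Prop :=
  forall (t : tree rank) (v : valuation t) (a b b' : k.-tuple (node t)),
    sat (update_tuple (update_tuple v xs a) ys b) phi ->
    sat (update_tuple (update_tuple v xs a) ys b') phi ->
    b = b'.

Fixpoint is_FO_DTC (phi : formula) : Prop :=
  match phi with
  | FLab _ _ | FEdg _ _ _ | FLe _ _ | FEq _ _ => True
  | FNot phi | FEx _ phi | FAll _ phi => is_FO_DTC phi
  | FAnd phi psi | FOr phi psi => is_FO_DTC phi /\ is_FO_DTC psi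
  | FTC phi xs ys _ _ =>
      [/\ uniq (xs ++ ys), is_FO_DTC phi & functional phi xs ys]
  end.

(* Only used for closed formulas, whose truth does not depend on v. *)
Definition models (t : tree rank) (phi : formula) : Prop :=
  forall v : valuation t, sat v phi.

End Logic.

Section Operations.
Variables (Sigma : finType) (k : nat) (X : finType).

Inductive test : Type :=
  | TLab (i : 'I_k) (s : Sigma)
  | TPeb (i : 'I_k) (x : X)
  | TChno (i : 'I_k) (j : nat).

Inductive operation : Type :=
  | Up (i : 'I_k)
  | Down (i : 'I_k) (j : nat)
  | Drop (i : 'I_k) (x : X)
  | Retrieve (x : X)
  | Pos (tau : test)
  | Neg (tau : test).

Lemma test_comparable : comparable test.
Proof. by move=> a b; rewrite /decidable; decide equality; apply: eq_comparable. Qed.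
HB.instance Definition _ := hasDecEq.Build test (compareP test_comparable).

Lemma operation_comparable : comparable operation.
Proof. by move=> a b; rewrite /decidable; decide equality; apply: eq_comparable. Qed.
HB.instance Definition _ :=
  hasDecEq.Build operation (compareP operation_comparable).

Definition is_negation (chi1 chi2 : operation) : Prop :=
  exists tau, chi1 = Neg tau /\ chi2 = Pos tau.

End Operations.

Section Automata.
Variables (Sigma : finType) (rank : Sigma -> nat) (k : nat).

(* The sequence of instructions is only used through membership. *)
Record automaton : Type := Automaton {
  state : finType;
  pebble : finType;
  init : state;
  accepting : {set state};
  instructions : seq (state * operation Sigma k pebble * state)
}.

Definition deterministic (A : automaton) : Prop :=
  forall (p q1 q2 : state A) (chi1 chi2 : operation Sigma k (pebble A)),
    (p, chi1, q1) \in instructions A ->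
    (p, chi2, q2) \in instructions A ->
    (p, chi1, q1) != (p, chi2, q2) ->
    is_negation chi1 chi2 \/ is_negation chi2 chi1.

Section Runs.
Variables (A : automaton) (t : tree rank).

Definition stack : Type := seq (pebble A * node t).

(* The top of the stack is the head of the sequence. *)
Definition configuration : Type := (state A * k.-tuple (node t) * stack)%type.

Definition move_head (u : k.-tuple (node t)) (i : 'I_k) (w : node t)
    : k.-tuple (node t) :=
  [tuple if j == i then w else tnth u j | j < k].

Definition holds (tau : test Sigma k (pebble A)) (u : k.-tuple (node t))
    (alpha : stack) : Prop :=
  match tau with
  | TLab i s => has_label s (tnth u i)
  | TPeb i x => (x, tnth u i) \in alpha
  | TChno i j => child_number (tnth u i) = j
  end.

Definition exec (chi : operation Sigma k (pebble A))
    (u : k.-tuple (node t)) (alpha : stack)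
    (u' : k.-tuple (node t)) (alpha' : stack) : Prop :=
  match chi with
  | Up i => alpha' = alpha /\
      exists w j, is_child j w (tnth u i) /\ u' = move_head u i w
  | Down i j => alpha' = alpha /\
      exists w, is_child j (tnth u i) w /\ u' = move_head u i w
  | Drop i x => u' = u /\
      (x \notin unzip1 alpha /\ alpha' = (x, tnth u i) :: alpha)
  | Retrieve x => u' = u /\ exists w, alpha = (x, w) :: alpha'
  | Pos tau => (u' = u /\ alpha' = alpha) /\ holds tau u alpha
  | Neg tau => (u' = u /\ alpha' = alpha) /\ ~ holds tau u alpha
  end.

Definition step (c c' : configuration) : Prop :=
  let: (p, u, alpha) := c in
  let: (q, u', alpha') := c' in
  exists chi, (p, chi, q) \in instructions A /\ exec chi u alpha u' alpha'.

Definition halting (c : configuration) : Prop := forall c', ~ step c c'.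

Definition root_config (p : state A) : configuration :=
  (p, nseq_tuple k (tree_root t), [::]).

Definition accepts : Prop :=
  exists p, [/\ p \in accepting A,
    clos_refl_trans configuration step (root_config (init A)) (root_config p)
    & halting (root_config p)].

End Runs.
End Automata.

(* Main.v *)
(** The automaton evaluates a formula with the values of the variables marked by
    pebbles: a quantifier drops a pebble on every node in turn, in preorder.
    For a functional step relation, the pairs leading to the target [b] of a
    closure form a tree rooted at [b] (once the step out of [b] is discarded),
    and following Sipser one searches this tree backwards from [b], depth
    first, for the source.  The heads hold the current tuple, and the first
    child, the next sibling and the parent of a tuple are themselves definable,
    hence are found by searching for a tuple with nested pebbles while the
    current one is pebbled.  This never loops, and needs only [k] heads.

    Conversely, by induction on the number of pebbles that are not yet on the
    stack, the computations between a [drop] and its matching [retrieve] are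
    treated as single steps, and states are eliminated by Kleene's construction.
    Only closures of first returns to an eliminated state are needed, and these
    are functional when the automaton is deterministic. *)

From Stdlib Require Import Relation_Operators Operators_Properties.
From Stdlib Require Import FunctionalExtensionality Classical.
From HB Require Import structures.
Require Import Defs.
From mathcomp Require Import all_boot zify.

Set Implicit Arguments.
Unset Strict Implicit.
Unset Printing Implicit Defensive.

(** * Nodes in preorder *)

(** Iterating a functional relation forwards from the source may enter a cycle, and the automaton
    would then run forever instead of answering no; negation needs a definite answer, so every
    subprogram has to terminate. Each one also gives the stack back unchanged. The heads are scratch
    space: [Retrieve] works wherever they stand, and the values of variables are found again by
    scanning for their pebbles. Subformulas are evaluated in a nested manner, so the pebbles of an
    inner evaluation are always above those of the outer one, as the stack discipline demands.

    In the converse direction the obstacle is that [functional] speaks of all trees and all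
    valuations, so macro steps must be shown functional for every placement of the pebbles, also
    those that no run produces. An excursion has a unique end because, for a deterministic
    automaton, a configuration in which the top pebble can be retrieved allows nothing else. A loop
    at a state [r] that avoids [r] in between has a unique end because it stops at the first
    return. *)

Section TreeNodes.
Variables (Sigma : finType) (rank : Sigma -> nat).
Implicit Types (t : tree rank) (a b p : seq nat).

Lemma subtree_at_cat t a b :
  subtree_at t (a ++ b) = obind (fun t' => subtree_at t' b) (subtree_at t a).
Proof.
elim: a t => [|[|i] a IH] //= [s c].
by case: insub => [j|] //=.
Qed.

Definition rank_at t a : nat :=
  if subtree_at t a is Some (TreeNode s c) then rank s else 0.

Lemma subtree_at_rcons t a j :
  isSome (subtree_at t (rcons a j)) = (0 < j <= rank_at t a).
Proof.
rewrite -cats1 subtree_at_cat /rank_at.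
case: (subtree_at t a) => [[s c]|] /=; last by case: j.
case: j => [|j] //=; case: insubP => [i /= -> //|].
by move=> /negbTE ->.
Qed.

Lemma prefix_node t a b : isSome (subtree_at t (a ++ b)) -> isSome (subtree_at t a).
Proof. by rewrite subtree_at_cat; case: (subtree_at t a). Qed.

Lemma rank_at_label t s (x : node t) : has_label s x -> rank_at t (addr x) = rank s.
Proof. by rewrite /rank_at => -[c ->]. Qed.

Lemma label_exists t (x : node t) : exists s, has_label s x.
Proof.
case: x => a Ha; rewrite /has_label /=.
by case E: (subtree_at t a) Ha => [[s c]|] // _; exists s, c.
Qed.

Lemma label_unique t s s' (x : node t) : has_label s x -> has_label s' x -> s = s'.
Proof. by move=> [c Hc] [c' Hc']; move: Hc; rewrite Hc' => -[]. Qed.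

Lemma nodeP t a : isSome (subtree_at t a) -> exists x : node t, addr x = a.
Proof. by move=> H; exists (Node H). Qed.

Lemma node_inj t (x y : node t) : addr x = addr y -> x = y.
Proof. exact: val_inj. Qed.

Lemma is_child_bounds t i (x y : node t) :
  is_child i x y -> 0 < i <= rank_at t (addr x).
Proof.
by move/eqP=> E; rewrite -subtree_at_rcons -E; case: y {E}.
Qed.

Lemma child_exists t i (x : node t) :
  0 < i <= rank_at t (addr x) -> exists y, is_child i x y.
Proof.
by rewrite -subtree_at_rcons => /nodeP[y Hy]; exists y; apply/eqP.
Qed.

Lemma is_child_inj t i j (x x' y : node t) :
  is_child i x y -> is_child j x' y -> x = x' /\ i = j.
Proof.
move=> /eqP E /eqP; rewrite E => /rcons_inj[H ->].
by split=> //; apply: node_inj.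
Qed.

Lemma is_child_fun t i (x y y' : node t) : is_child i x y -> is_child i x y' -> y = y'.
Proof. by move=> /eqP E /eqP E'; apply: node_inj; rewrite E E'. Qed.

Lemma is_child_number t i (x y : node t) : is_child i x y -> child_number y = i.
Proof. by rewrite /child_number => /eqP ->; rewrite last_rcons. Qed.

Lemma root_or_child t (y : node t) : 
  y = tree_root t \/ exists x, is_child (child_number y) x y.
Proof.
case: y => a; case: (lastP a) => [|p i] H; first by left; apply: node_inj.
right; have [x Hx] : exists x : node t, addr x = p.
  by apply: nodeP; move: H; rewrite -cats1; apply: prefix_node.
by exists x; rewrite /is_child /child_number /= Hx last_rcons.
Qed.

Lemma child_number0 t (y : node t) : child_number y = 0 <-> y = tree_root t.
Proof.
split=> [E|-> //]; case: (root_or_child y) => // -[x].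
by move/is_child_bounds; rewrite E.
Qed.

Definition max_rank : nat := \max_(s : Sigma) rank s.

Lemma rank_at_le t a : rank_at t a <= max_rank.
Proof.
rewrite /rank_at; case: (subtree_at t a) => [[s c]|] //.
exact: leq_bigmax.
Qed.

Lemma child_number_le t (y : node t) : child_number y <= max_rank.
Proof.
case: (root_or_child y) => [->//|[x /is_child_bounds /andP[_ H]]].
exact: leq_trans H (rank_at_le _ _).
Qed.

Lemma root_ancestor t (x : node t) : (forall y, ancestor x y) <-> x = tree_root t.
Proof.
split=> [H|-> y]; last by rewrite /ancestor prefix0s.
by apply: node_inj; apply/eqP; rewrite -prefixs0; apply: (H (tree_root t)).
Qed.

Lemma ancestor_parent t i (x y z : node t) :
  is_child i z y -> ancestor x y = (x == y) || ancestor x z.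
Proof.
move=> /eqP E; rewrite /ancestor -(inj_eq val_inj) /= E; move: (addr x) (addr z) => a b.
elim: b a => [|c b IH] [|d a] //=; first by rewrite eqseq_cons orbF; case: a.
by rewrite IH eqseq_cons -andb_orr.
Qed.

(* [climb p] is the first node visited after the subtree at [p] in preorder;
   [climb_rev] takes the address reversed. *)
Fixpoint climb_rev t (q : seq nat) : option (seq nat) :=
  if q is j :: q' then
    if j < rank_at t (rev q') then Some (rcons (rev q') j.+1) else climb_rev t q'
  else None.

Definition climb t a := climb_rev t (rev a).

Definition preorder_next t a : option (seq nat) :=
  if 0 < rank_at t a then Some (rcons a 1) else climb t a.

Lemma climb_rcons t a j :
  climb t (rcons a j) =
  if j < rank_at t a then Some (rcons a j.+1) else climb t a.
Proof. by rewrite /climb rev_rcons /= revK. Qed.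

(** Both ends are optional addresses, so that the walks through consecutive sibling subtrees can be
    concatenated; [None] stands for the end of the tree. *)
Fixpoint traversal t (o : option (seq nat)) (l : seq (seq nat))
    (e : option (seq nat)) : Prop :=
  if l is a :: l' then o = Some a /\ traversal t (preorder_next t a) l' e
  else o = e.

Lemma traversal_cat t o l1 m l2 e :
  traversal t o l1 m -> traversal t m l2 e -> traversal t o (l1 ++ l2) e.
Proof. by elim: l1 o => [o -> //|a l1 IH o /= [-> H] H']; split; auto. Qed.

Fixpoint addresses t : seq (seq nat) :=
  let: TreeNode s c := t in
  [::] :: flatten [seq [seq i.+1 :: a | a <- addresses (c i)] | i : 'I_(rank s)].

Lemma mem_addresses a t : (a \in addresses t) = isSome (subtree_at t a).
Proof.
elim: a t => [|i a IH] [s c] //=; rewrite in_cons /=.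
case: i => [|i].
  by apply/negP => /flattenP[l /mapP[j _ ->] /mapP[b _ []]].
case: insubP => [j Hj Ej|Hi] /=.
  rewrite -IH; apply/flattenP/idP.
    move=> [l /mapP[j' _ ->] /mapP[b Hb [E ->]]].
    by rewrite (_ : j = j') //; apply: val_inj; rewrite /= Ej.
  move=> Ha; exists [seq j.+1 :: b | b <- addresses (c j)].
    by apply: (map_f (fun j : 'I_(rank s) => [seq j.+1 :: b | b <- addresses (c j)])); rewrite mem_enum.
  by apply/mapP; exists a; rewrite ?Ej.
apply/negP => /flattenP[l /mapP[j _ ->] /mapP[b _ [E _]]].
by rewrite E ltn_ord in Hi.
Qed.

Lemma traversal_subtree t t0 p :
  subtree_at t p = Some t0 ->
  traversal t (Some p) [seq p ++ a | a <- addresses t0] (climb t p).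
Proof.
(* The subtrees sit inside a finite function, hence the explicit [fix] on the tree. *)
move: t0 p; fix IH 1 => -[s c] p Hp /=; rewrite cats0; split=> //.
have Er : rank_at t p = rank s by rewrite /rank_at Hp.
have Hsub (i : 'I_(rank s)) : subtree_at t (rcons p i.+1) = Some (c i).
  rewrite -cats1 subtree_at_cat Hp /=; case: insubP => [j _ Ej|]; last by rewrite ltn_ord.
  by congr (Some (c _)); apply: val_inj.
(* [IH] is applied to the children here and then cleared, so that later automation cannot close a
   goal by an unguarded call. *)
have Hstep (i : 'I_(rank s)) := IH (c i) _ (Hsub i).
clear IH.
rewrite /preorder_next Er map_flatten -map_comp.
(* The first [j] children are done and [es] lists the [m] others. The starting point is the value of
   [climb] after the [j]-th child, as given by [climb_rcons]. *)
have Hm : forall (m j : nat) (es : seq 'I_(rank s)), [seq val i | i <- es] = iota j m ->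
  j + m = rank s ->
  traversal t (if j < rank s then Some (rcons p j.+1) else climb t p)
   (flatten [seq (map (cat p) \o (fun i : 'I_(rank s) => [seq i.+1 :: a | a <- addresses (c i)])) i | i <- es]) (climb t p).
  elim=> [|m IHm] j [|e es] //=; first by rewrite addn0 => _ ->; rewrite ltnn.
  move=> [Ee Ees] Ej; have Hj : j < rank s by lia.
  rewrite Hj; apply: traversal_cat (IHm j.+1 es Ees _); last by lia.
  have := Hstep e; rewrite climb_rcons Er Ee -map_comp.
  by congr (traversal _ _ _ _); apply: eq_map => a /=; rewrite -Ee -cats1 -catA.
apply: (Hm (rank s) 0) => //.
by rewrite val_enum_ord.
Qed.

Lemma traversal_addresses t : traversal t (Some [::]) (addresses t) None.
Proof.
have := @traversal_subtree t t [::] erefl.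
by rewrite (_ : [seq [::] ++ a | a <- _] = addresses t) // -[RHS]map_id.
Qed.

Definition nodes t : seq (node t) := pmap insub (addresses t).

Lemma map_addr_nodes t : [seq addr x | x <- nodes t] = addresses t.
Proof.
rewrite /nodes; rewrite pmap_filter; last exact: insubK.
apply/all_filterP/allP => a; rewrite mem_addresses => H.
by rewrite (insubT (fun a => isSome (subtree_at t a)) H).
Qed.

Lemma mem_nodes t (x : node t) : x \in nodes t.
Proof.
rewrite -(mem_map (@node_inj t)) map_addr_nodes mem_addresses.
by case: x.
Qed.

HB.instance Definition _ t := [Countable of node t by <:].

(** [undup] spares a proof that the preorder list has no repetition. *)
Lemma node_finite_axiom t : Finite.axiom (undup (nodes t)).
Proof.
by move=> x; rewrite count_uniq_mem ?undup_uniq // mem_undup mem_nodes.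
Qed.
HB.instance Definition _ t := isFinite.Build (node t) (@node_finite_axiom t).

End TreeNodes.

(** * Flowcharts *)

Section Flowcharts.
Variables (Sigma : finType) (rank : Sigma -> nat) (k : nat) (X : finType).

(* [exec] and [holds] depend on an automaton only through its pebbles. *)
Definition idle_automaton : automaton Sigma k :=
  @Automaton Sigma k unit X tt set0 [::].

Definition config (t : tree rank) : Type :=
  (k.-tuple (node t) * seq (X * node t))%type.

Definition xholds t (tau : test Sigma k X) (c : config t) : Prop :=
  @holds Sigma rank k idle_automaton t tau c.1 c.2.

Definition xexec t (chi : operation Sigma k X) (c c' : config t) : Prop :=
  @exec Sigma rank k idle_automaton t chi c.1 c.2 c'.1 c'.2.

Inductive instr (T : Type) : Type :=
  | Act (chi : operation Sigma k X) (n : T)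
  | Branch (tau : test Sigma k X) (n1 n2 : T).

Definition instr_map (T T' : Type) (h : T -> T') (i : instr T) : instr T' :=
  match i with
  | Act chi n => Act chi (h n)
  | Branch tau n1 n2 => Branch tau (h n1) (h n2)
  end.

(* The exits are the elements of [E]; every point has one operation or one test,
   so that flowcharts compile to deterministic automata. *)
Record flowchart (E : finType) : Type := Flowchart {
  point : finType;
  entry : point;
  code : point -> instr (point + E)
}.

Definition fstep t (E : finType) (F : flowchart E)
    (c c' : (point F + E) * config t) : Prop :=
  match c.1 with
  | inl s =>
      match code s with
      | Act chi n => c'.1 = n /\ xexec chi c.2 c'.2
      | Branch tau n1 n2 =>
          c'.2 = c.2 /\ ((xholds tau c.2 /\ c'.1 = n1) \/ (~ xholds tau c.2 /\ c'.1 = n2))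
      end
  | inr _ => False
  end.

(** Total correctness. Asking for one terminating run is enough, because the automaton compiled from
    a flowchart is deterministic. *)
Definition wp t (E : finType) (F : flowchart E) (c : config t)
    (Q : E -> config t -> Prop) : Prop :=
  exists e c', clos_refl_trans _ (@fstep t E F) (inl (entry F), c) (inr e, c') /\ Q e c'.

Lemma wp_mono t (E : finType) (F : flowchart E) c (Q Q' : E -> config t -> Prop) :
  wp F c Q -> (forall e c', Q e c' -> Q' e c') -> wp F c Q'.
Proof. by move=> [e [c' [H1 H2]]] H; exists e, c'; split; auto. Qed.

Section Constructors.
Implicit Type t : tree rank.
Variable head0 : 'I_k.

(** The entry must be a point, so even the trivial flowchart spends one test, whose two outcomes
    lead to the same exit. *)
Definition ret (E : finType) (e : E) : flowchart E :=
  @Flowchart E unit tt (fun _ => Branch (TChno _ _ head0 0) (inr e) (inr e)).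

Definition act (chi : operation Sigma k X) : flowchart unit :=
  @Flowchart unit unit tt (fun _ => Act chi (inr tt)).

Definition check (tau : test Sigma k X) : flowchart bool :=
  @Flowchart bool unit tt (fun _ => Branch tau (inr true) (inr false)).

Section Bind.
Variables (E E' : finType) (F : flowchart E) (G : E -> flowchart E').

Let bpoint : finType := (point F + {e : E & point (G e)})%type.
Let first_part (x : point F + E) : bpoint + E' :=
  match x with
  | inl s => inl (inl s)
  | inr e => inl (inr (Tagged (fun e => point (G e)) (entry (G e))))
  end.
Let second_part e (x : point (G e) + E') : bpoint + E' :=
  match x with
  | inl s => inl (inr (Tagged (fun e => point (G e)) s))
  | inr e' => inr e'
  end.

Definition bind : flowchart E' :=
  @Flowchart E' bpoint (inl (entry F))
    (fun x => match x with
              | inl s => instr_map first_part (code s)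
              | inr u => instr_map (@second_part (tag u)) (code (tagged u))
              end).

Lemma wp_bind t c (Q : E' -> config t -> Prop) :
  wp F c (fun e c' => wp (G e) c' Q) -> wp bind c Q.
Proof.
move=> [e [c1 [H1 [e' [c2 [H2 HQ]]]]]]; exists e', c2; split=> //.
apply: (@rt_trans _ _ _ (first_part (inr e), c1)).
  have: forall a b, clos_refl_trans _ (@fstep t _ F) a b ->
    clos_refl_trans _ (@fstep t _ bind) (first_part a.1, a.2) (first_part b.1, b.2).
    move=> a b; elim=> [{}a {}b H|{}a|a1 a2 a3 _ Ha _ Hb]; [|exact: rt_refl|exact: rt_trans Ha Hb].
    apply: rt_step; case: a b H => [[s|//] c0] [y c'] /=; rewrite /fstep /=.
    case: (code s) => [chi n [-> He]|tau n1 n2 [-> H]] //=.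
    by split=> //; case: H => -[H ->]; [left|right].
  by move/(_ _ _ H1).
have: forall a b, clos_refl_trans _ (@fstep t _ (G e)) a b ->
    clos_refl_trans _ (@fstep t _ bind) (second_part a.1, a.2) (second_part b.1, b.2).
  move=> a b; elim=> [{}a {}b H|{}a|a1 a2 a3 _ Ha _ Hb]; [|exact: rt_refl|exact: rt_trans Ha Hb].
  apply: rt_step; case: a b H => [[s|//] c0] [y c'] /=; rewrite /fstep /=.
  case: (code s) => [chi n [-> He]|tau n1 n2 [-> H]] //=.
  by split=> //; case: H => -[H ->]; [left|right].
by move/(_ _ _ H2).
Qed.
End Bind.

Section Iterate.
Variables (S E : finType) (body : S -> flowchart (S + E)%type).

Let ipoint : finType := {s : S & point (body s)}.
Let next_part s (x : point (body s) + (S + E)) : ipoint + E :=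
  match x with
  | inl q => inl (Tagged (fun s => point (body s)) q)
  | inr (inl s') => inl (Tagged (fun s => point (body s)) (entry (body s')))
  | inr (inr e) => inr e
  end.

Definition iterate (s : S) : flowchart E :=
  @Flowchart E ipoint (Tagged (fun s => point (body s)) (entry (body s)))
    (fun x => instr_map (@next_part (tag x)) (code (tagged x))).

(** A single unfolding of the loop. Termination is the business of each use: induction on the depth
    of a node, on the nodes still to be scanned, or on the search tree. *)
Lemma wp_iterate t s c (Q : E -> config t -> Prop) :
  wp (body s) c (fun r c' => match r with
                             | inl s' => wp (iterate s') c' Q
                             | inr e => Q e c'
                             end) ->
  wp (iterate s) c Q.
Proof.
move=> [r [c1 [H1 HQ]]].
have: forall a b, clos_refl_trans _ (@fstep t _ (body s)) a b ->
    clos_refl_trans _ (@fstep t _ (iterate s)) (next_part a.1, a.2) (next_part b.1, b.2).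
  move=> a b; elim=> [{}a {}b H|{}a|a1 a2 a3 _ Ha _ Hb]; [|exact: rt_refl|exact: rt_trans Ha Hb].
  apply: rt_step; case: a b H => [[q|//] c0] [y c'] /=; rewrite /fstep /=.
  case: (code q) => [chi n [-> He]|tau n1 n2 [-> H]] //=.
  by split=> //; case: H => -[H ->]; [left|right].
move/(_ _ _ H1); case: r HQ {H1} => [s'|e] /= HQ H1; last by exists e, c1.
case: HQ => [e [c2 [H2 HQ]]]; exists e, c2; split=> //.
exact: rt_trans H1 H2.
Qed.
End Iterate.

Lemma xholds_dec t tau (c : config t) : xholds tau c \/ ~ xholds tau c.
Proof.
case: tau => [i s|i x|i j]; rewrite /xholds /=.
- have [s' Hs'] := label_exists (tnth c.1 i).
  case: (eqVneq s s') => [->|ne]; [by left|right => H].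
  by rewrite (label_unique H Hs') eqxx in ne.
- by case: (_ \in _); [left|right].
- by case: (eqVneq (child_number (tnth c.1 i)) j) => [->|/eqP]; [left|right].
Qed.

Lemma wp_ret t (E : finType) (e : E) c (Q : E -> config t -> Prop) :
  Q e c -> wp (ret e) c Q.
Proof.
move=> HQ; exists e, c; split=> //; apply: rt_step; rewrite /fstep /=; split=> //.
by case: (xholds_dec (TChno _ _ head0 0) c); [left|right].
Qed.

Lemma wp_act t chi (c c' : config t) (Q : unit -> config t -> Prop) :
  xexec chi c c' -> Q tt c' -> wp (act chi) c Q.
Proof. by move=> H HQ; exists tt, c'; split=> //; apply: rt_step. Qed.

Lemma wp_check t tau (c : config t) (Q : bool -> config t -> Prop) :
  (xholds tau c -> Q true c) -> (~ xholds tau c -> Q false c) ->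
  wp (check tau) c Q.
Proof.
move=> HT HF; case: (xholds_dec tau c) => H.
  by exists true, c; split; auto; apply: rt_step; rewrite /fstep /=; split=> //; left.
by exists false, c; split; auto; apply: rt_step; rewrite /fstep /=; split=> //; right.
Qed.

Lemma tnth_move_head t (u : k.-tuple (node t)) i w j :
  tnth (move_head u i w) j = if j == i then w else tnth u j.
Proof. by rewrite tnth_mktuple. Qed.

Lemma move_head_twice t (u : k.-tuple (node t)) i w w' :
  move_head (move_head u i w) i w' = move_head u i w'.
Proof. by apply: eq_from_tnth => j; rewrite !tnth_move_head; case: eqP. Qed.

Lemma move_head_id t (u : k.-tuple (node t)) i : move_head u i (tnth u i) = u.
Proof. by apply: eq_from_tnth => j; rewrite !tnth_move_head; case: eqP => [->|]. Qed.

Section Choose.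
Variables (E : finType) (f : E -> test Sigma k X).

Definition choose : flowchart (option E) :=
  foldr (fun e F => bind (check (f e)) (fun b => if b then ret (Some e) else F))
    (ret None) (enum E).

Lemma wp_choose t e c (Q : option E -> config t -> Prop) :
  xholds (f e) c -> (forall e', xholds (f e') c -> e' = e) ->
  Q (Some e) c -> wp choose c Q.
Proof.
move=> He Hu HQ; rewrite /choose; have: e \in enum E by rewrite mem_enum.
elim: (enum E) => [//|e' es IH] /=; rewrite in_cons => Hin.
apply/wp_bind/wp_check => [/Hu ->|Hn]; first exact: wp_ret.
case/predU1P: Hin => [E'|]; last exact: IH.
by rewrite E' in He.
Qed.
End Choose.

Definition read_label (i : 'I_k) : flowchart (option Sigma) :=
  choose (fun s => TLab X i s).

Lemma wp_read_label t i s u alpha (Q : option Sigma -> config t -> Prop) :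
  has_label s (tnth u i) -> Q (Some s) (u, alpha) -> wp (read_label i) (u, alpha) Q.
Proof. by move=> H; apply: wp_choose => // s' H'; apply: label_unique H' H. Qed.

Definition read_child_number (i : 'I_k) : flowchart (option 'I_(max_rank rank).+1) :=
  choose (fun j : 'I_(max_rank rank).+1 => TChno _ X i j).

Lemma wp_read_child_number t i u alpha
    (Q : option 'I_(max_rank rank).+1 -> config t -> Prop) :
  (forall j : 'I_(max_rank rank).+1,
    child_number (tnth u i) = j -> Q (Some j) (u, alpha)) ->
  wp (read_child_number i) (u, alpha) Q.
Proof.
have Hj : child_number (tnth u i) < (max_rank rank).+1 by rewrite ltnS child_number_le.
move=> /(_ (Ordinal Hj) erefl) H; apply: wp_choose H => // j'.
by rewrite /xholds /= => E; apply: val_inj; rewrite /= E.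
Qed.

Lemma xexec_up t (u : k.-tuple (node t)) alpha i w j :
  is_child j w (tnth u i) -> xexec (Up _ _ i) (u, alpha) (move_head u i w, alpha).
Proof. by move=> H; split=> //; exists w, j. Qed.

Definition goto_root (i : 'I_k) : flowchart unit :=
  iterate (fun _ : unit =>
    bind (check (TChno _ _ i 0)) (fun b =>
      if b then ret (inr tt)
      else bind (act (Up _ _ i)) (fun _ => ret (inl tt)))) tt.

Lemma wp_goto_root t i u alpha (Q : unit -> config t -> Prop) :
  Q tt (move_head u i (tree_root t), alpha) -> wp (goto_root i) (u, alpha) Q.
Proof.
have [n Hn] := ubnP (size (addr (tnth u i))).
elim: n u Hn => // n IH u Hn HQ.
apply/wp_iterate/wp_bind/wp_check; rewrite /xholds /=.
  by move/child_number0 => E; apply: wp_ret; rewrite -E move_head_id in HQ.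
move=> H; case: (root_or_child (tnth u i)) => [/child_number0//|[w Hw]].
apply/wp_bind/wp_act; first exact: xexec_up Hw.
apply/wp_ret/IH; last by rewrite move_head_twice.
rewrite tnth_move_head eqxx; move: Hn.
by rewrite (eqP Hw) size_rcons ltnS.
Qed.

Definition climb_head (i : 'I_k) : flowchart bool :=
  iterate (fun _ : unit =>
    bind (read_child_number i) (fun oj =>
      if oj is Some j then
        if val j == 0 then ret (inr false)
        else bind (act (Up _ _ i)) (fun _ =>
          bind (read_label i) (fun os =>
            if os is Some s then
              if j < rank s then bind (act (Down _ _ i j.+1)) (fun _ => ret (inr true))
              else ret (inl tt)
            else ret (inr false)))
      else ret (inr false))) tt.

(** On failure the head has arrived at the root; quantifying over every final node [w] keeps the
    hypothesis stable under the induction on depth. *)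
Lemma wp_climb_head t i u alpha (Q : bool -> config t -> Prop) :
  (forall w, climb t (addr (tnth u i)) = Some (addr w) ->
     Q true (move_head u i w, alpha)) ->
  (forall w, climb t (addr (tnth u i)) = None -> Q false (move_head u i w, alpha)) ->
  wp (climb_head i) (u, alpha) Q.
Proof.
have [n Hn] := ubnP (size (addr (tnth u i))).
elim: n u Hn => // n IH u Hn HT HF.
apply/wp_iterate/wp_bind/wp_read_child_number => j Hj; case: eqP => [E|ne].
  apply: wp_ret; rewrite -{1}(move_head_id u i); apply: HF.
  by rewrite E in Hj; rewrite ((child_number0 _).1 Hj).
case: (root_or_child (tnth u i)) => [/child_number0 E|[w]].
  by case: ne; exact: etrans (esym Hj) E.
rewrite Hj => Hw; apply/wp_bind/wp_act; first exact: xexec_up Hw.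
have [s Hs] := label_exists w.
apply/wp_bind/(@wp_read_label _ _ s); first by rewrite tnth_move_head eqxx.
have Eu : addr (tnth u i) = rcons (addr w) j by apply/eqP.
have Ec := climb_rcons t (addr w) j; rewrite -Eu (rank_at_label Hs) in Ec.
case: ifP Ec => Hlt Ec.
  have [w' Hw'] : exists w', is_child j.+1 w w'.
    by apply: child_exists; rewrite (rank_at_label Hs).
  apply/wp_bind/(@wp_act _ _ _ (move_head (move_head u i w) i w', alpha)).
    by split=> //; exists w'; rewrite tnth_move_head eqxx.
  by apply: wp_ret; rewrite move_head_twice; apply: HT; rewrite Ec (eqP Hw').
have Eh : tnth (move_head u i w) i = w by rewrite tnth_move_head eqxx.
apply: wp_ret; apply: IH; rewrite ?Eh.
- by move: Hn; rewrite Eu size_rcons ltnS.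
- by move=> w' E'; rewrite move_head_twice; apply: HT; rewrite Ec.
- by move=> w' E'; rewrite move_head_twice; apply: HF; rewrite Ec.
Qed.

Definition next_node (i : 'I_k) : flowchart bool :=
  bind (read_label i) (fun os =>
    if os is Some s then
      if 0 < rank s then bind (act (Down _ _ i 1)) (fun _ => ret true)
      else climb_head i
    else ret false).

Lemma wp_next_node t i u alpha (Q : bool -> config t -> Prop) :
  (forall w, preorder_next t (addr (tnth u i)) = Some (addr w) ->
     Q true (move_head u i w, alpha)) ->
  (forall w, preorder_next t (addr (tnth u i)) = None ->
     Q false (move_head u i w, alpha)) ->
  wp (next_node i) (u, alpha) Q.
Proof.
move=> HT HF; have [s Hs] := label_exists (tnth u i).
apply/wp_bind/(@wp_read_label _ _ s) => //; move: HT HF.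
rewrite /preorder_next (rank_at_label Hs); case: ifP => Hr HT HF.
  have [w Hw] : exists w, is_child 1 (tnth u i) w.
    by apply: child_exists; rewrite (rank_at_label Hs).
  apply/wp_bind/(@wp_act _ _ _ (move_head u i w, alpha)).
    by split=> //; exists w.
  by apply: wp_ret; apply: HT; rewrite (eqP Hw).
exact: wp_climb_head.
Qed.

(** The invariant of all preorder scans: [l] is what remains to be visited, starting with [x], and
    induction on [l] shows that the scan ends. *)
Definition suffix_from t (x : node t) (l : seq (node t)) : Prop :=
  traversal t (Some (addr x)) [seq addr y | y <- l] None.

Lemma suffix_from_root t : suffix_from (tree_root t) (nodes t).
Proof. by rewrite /suffix_from map_addr_nodes; apply: traversal_addresses. Qed.

Lemma suffix_from_cons t (x : node t) l : suffix_from x l ->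
  exists2 l', l = x :: l' &
   (preorder_next t (addr x) = None /\ l' = [::]) \/
   (exists2 y, preorder_next t (addr x) = Some (addr y) & suffix_from y l').
Proof.
case: l => [//|y l] [[/node_inj ->]] H; exists l => //.
case: l H => [//|z l] /=; first by left.
by move=> [-> H]; right; exists z.
Qed.

Lemma wp_next_node_suffix t i u alpha x l (Q : bool -> config t -> Prop) :
  tnth u i = x -> suffix_from x (x :: l) ->
  (forall y, suffix_from y l -> Q true (move_head u i y, alpha)) ->
  (l = [::] -> forall w, Q false (move_head u i w, alpha)) ->
  wp (next_node i) (u, alpha) Q.
Proof.
move=> Hx /suffix_from_cons[_ [<-] Hl] HT HF.
apply: wp_next_node; rewrite Hx => w E; case: Hl; rewrite E.
- by case.
- by move=> [y [/node_inj ->]]; apply: HT.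
- by move=> [_ El]; apply: HF.
- by case.
Qed.

Definition seek (i : 'I_k) (x : X) : flowchart unit :=
  bind (goto_root i) (fun _ => iterate (fun _ : unit =>
    bind (check (TPeb _ i x)) (fun b =>
      if b then ret (inr tt)
      else bind (next_node i) (fun _ => ret (inl tt)))) tt).

Lemma wp_seek t i x w u (alpha : seq (X * node t)) (Q : unit -> config t -> Prop) :
  (x, w) \in alpha -> (forall w', (x, w') \in alpha -> w' = w) ->
  Q tt (move_head u i w, alpha) -> wp (seek i x) (u, alpha) Q.
Proof.
move=> Hw Huniq HQ; apply/wp_bind/wp_goto_root.
have := suffix_from_root t; have := mem_nodes w.
elim: (nodes t) (tree_root t) => [//|y l IH] r Hin Hs.
have [l' [Er _] _] := suffix_from_cons Hs; rewrite Er in Hin Hs => {y l' Er}.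
apply/wp_iterate/wp_bind/wp_check; rewrite /xholds /= tnth_move_head eqxx.
  by move/Huniq => E; apply: wp_ret; rewrite E.
move=> Hnin; have ne : w != r by apply: contra_notN Hnin => /eqP <-.
move: Hin; rewrite in_cons (negbTE ne) /= => Hin.
apply/wp_bind/(wp_next_node_suffix _ Hs); first by rewrite tnth_move_head eqxx.
- by move=> y Hy; apply: wp_ret; rewrite move_head_twice; apply: IH.
- by move=> El; rewrite El in Hin.
Qed.

Definition in_sequence (T : Type) (f : T -> flowchart unit) (s : seq T) : flowchart unit :=
  foldr (fun x F => bind (f x) (fun _ => F)) (ret tt) s.

End Constructors.
End Flowcharts.

Arguments ret {Sigma k X} head0 {E} e.
Arguments act {Sigma k X} chi.
Arguments check {Sigma k X} tau.
Arguments goto_root {Sigma k X} head0 i.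
Arguments next_node {Sigma} rank {k X} head0 i.
Arguments seek {Sigma} rank {k X} head0 i x.

(** * Evaluation of formulas with pebbles *)

Section Decidability.
Variables (Sigma : finType) (rank : Sigma -> nat) (k : nat) (hk : 0 < k).

Let h : 'I_k := Ordinal hk.

Definition override (V : eqType) (T : Type) (f : V -> T) (z : V) (w : T) : V -> T :=
  fun y => if y == z then w else f y.

Definition agree_off (V : eqType) (T : Type) (js : seq V) (f g : V -> T) : Prop :=
  forall z, z \notin js -> f z = g z.

(* [rho z] is the pebble marking the value of the variable [z]; the pebbles of
   [fr] are not in use. *)
Definition represents (X : finType) (V : eqType) (rho : V -> X) (fr : seq X)
    (t : tree rank) (v : V -> node t) (alpha : seq (X * node t)) : Prop :=
  [/\ uniq (unzip1 alpha), forall z, (rho z, v z) \in alpha &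
      forall x, x \in fr -> x \notin unzip1 alpha].

Definition predicate (V : Type) : Type := forall t : tree rank, (V -> node t) -> Prop.

(** Only the stack has to be restored; the heads may end anywhere. *)
Definition decider (X : finType) (V : eqType) (P : predicate V) (rho : V -> X)
    (fr : seq X) (F : flowchart Sigma k X bool) : Prop :=
  forall t v u alpha, represents rho fr v alpha ->
    wp F (u, alpha) (fun b (c : config k X t) => c.2 = alpha /\ (b <-> P t v)).

(** The bound [n] does not depend on [X], [rho] or [fr], so a predicate can be evaluated inside
    another one with whatever pebbles are still free there. *)
Definition pebble_decidable (V : eqType) (P : predicate V) : Prop :=
  exists n, forall (X : finType) (rho : V -> X) (fr : seq X),
    uniq fr -> n <= size fr -> exists F, decider P rho fr F.

Section Represents.
Variables (X : finType) (V : eqType) (rho : V -> X) (t : tree rank).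
Implicit Types (v : V -> node t) (fr : seq X) (alpha : seq (X * node t)).

Lemma stack_fun alpha x (w w' : node t) :
  uniq (unzip1 alpha) -> (x, w) \in alpha -> (x, w') \in alpha -> w = w'.
Proof.
elim: alpha => [//|[y z] alpha IH] /= /andP[Hy Hu]; rewrite !in_cons.
have Hn q : (y, q) \in alpha -> False.
  by move/(map_f fst) => H; rewrite H in Hy.
case/predU1P=> [E|H]; case/predU1P=> [E'|H'].
- by case: E E' => _ -> [_ ->].
- by case: E H' => -> _ /Hn.
- by case: E' H => -> _ /Hn.
- exact: IH.
Qed.

Lemma represents_fun fr v alpha z w :
  represents rho fr v alpha -> (rho z, w) \in alpha -> w = v z.
Proof. by case=> Hu Hv _ Hw; apply: stack_fun Hu Hw (Hv z). Qed.

Lemma represents_sub fr fr' v alpha :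
  {subset fr' <= fr} -> represents rho fr v alpha -> represents rho fr' v alpha.
Proof. by move=> H [H1 H2 H3]; split=> // x /H; apply: H3. Qed.

(** The former pebble of [z] stays on the stack but [rho] no longer points [z] to it, which handles
    a bound variable that shadows another one. *)
Lemma represents_push x fr v alpha z w :
  uniq (x :: fr) -> represents rho (x :: fr) v alpha ->
  represents (override rho z x) fr (override v z w) ((x, w) :: alpha).
Proof.
move=> /= /andP[Hx _] [H1 H2 H3]; split=> /=.
- by rewrite H3 ?mem_head.
- by move=> y; rewrite /override in_cons; case: (y == z); rewrite ?eqxx ?H2 ?orbT.
- move=> y Hy; rewrite in_cons negb_or H3 ?in_cons ?Hy ?orbT ?andbT //.
  by apply: contraNneq Hx => <-.
Qed.

Lemma xexec_drop x fr v alpha (u : k.-tuple (node t)) i :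
  represents rho (x :: fr) v alpha ->
  xexec (Drop _ i x) (u, alpha) (u, (x, tnth u i) :: alpha).
Proof. by case=> _ _ H; do !split=> //; apply: H; rewrite mem_head. Qed.

Lemma wp_seek_var i z fr v alpha u Q :
  represents rho fr v alpha -> Q tt (move_head u i (v z), alpha) ->
  wp (rank := rank) (seek rank h i (rho z)) (u, alpha) Q.
Proof.
move=> H; apply: wp_seek; first by case: H.
by move=> w'; apply: represents_fun H.
Qed.

Lemma wp_check_var i z fr v alpha u (Q : bool -> config k X t -> Prop) :
  represents rho fr v alpha ->
  Q (tnth u i == v z) (u, alpha) ->
  wp (check (TPeb _ i (rho z))) (u, alpha) Q.
Proof.
move=> H HQ; apply: wp_check; rewrite /xholds /=.
  by move/(represents_fun H) => E; rewrite E eqxx in HQ.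
move=> Hn; case: eqP HQ => // E; case: Hn; rewrite E; by case: H.
Qed.
End Represents.

Lemma represents_reindex (X : finType) (V V' : eqType) (s : V -> V') (rho : V' -> X) fr (t : tree rank)
    (v : V' -> node t) alpha :
  represents rho fr v alpha ->
  represents (fun z => rho (s z)) fr (fun z => v (s z)) alpha.
Proof. by case=> H1 H2 H3; split. Qed.

(** Since [represents] does not ask [rho] to be injective, several variables may share one pebble,
    and [s] may identify variables. *)
Lemma decidable_reindex (V V' : eqType) (s : V -> V') (P : predicate V) :
  pebble_decidable P -> pebble_decidable (fun t (v : V' -> node t) => P t (fun z => v (s z))).
Proof.
move=> [n H]; exists n => X rho fr Hu Hn.
have [F HF] := H X (fun z => rho (s z)) fr Hu Hn; exists F => t v u alpha Hr.
exact/HF/represents_reindex.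
Qed.

Lemma decidable_ext (V : eqType) (P P' : predicate V) :
  (forall t v, P t v <-> P' t v) -> pebble_decidable P -> pebble_decidable P'.
Proof.
move=> HP [n H]; exists n => X rho fr Hu Hn; have [F HF] := H X rho fr Hu Hn.
exists F => t v u alpha Hr; apply: wp_mono (HF t v u alpha Hr) _ => b c [-> Hb].
by rewrite -HP.
Qed.

Lemma decidable_not (V : eqType) (P : predicate V) :
  pebble_decidable P -> pebble_decidable (fun t v => ~ P t v).
Proof.
move=> [n H]; exists n => X rho fr Hu Hn; have [F HF] := H X rho fr Hu Hn.
exists (bind F (fun b => ret h (~~ b))) => t v u alpha Hr; apply: wp_bind.
apply: wp_mono (HF t v u alpha Hr) _ => b [u' alpha'] /= [-> Hb]; apply: wp_ret; split=> //.
by rewrite -Hb; split=> [/negP|/negP].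
Qed.

Lemma decidable_and (V : eqType) (P P' : predicate V) :
  pebble_decidable P -> pebble_decidable P' ->
  pebble_decidable (fun t v => P t v /\ P' t v).
Proof.
move=> [n H] [n' H']; exists (maxn n n') => X rho fr Hu Hn.
have [F HF] := H X rho fr Hu ltac:(lia).
have [F' HF'] := H' X rho fr Hu ltac:(lia).
exists (bind F (fun b => if b then F' else ret h false)) => t v u alpha Hr.
apply: wp_bind; apply: wp_mono (HF t v u alpha Hr) _ => b [u' alpha'] /= [-> Hb].
case: b Hb => Hb.
  apply: wp_mono (HF' t v u' alpha Hr) _ => b' c' [-> Hb']; split=> //.
  by rewrite Hb'; have := Hb.1 isT; tauto.
by apply: wp_ret; split=> //; split=> // -[/Hb].
Qed.

Lemma decidable_true (V : eqType) : pebble_decidable (fun t (v : V -> node t) => True).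
Proof. by exists 0 => X rho fr _ _; exists (ret h true) => t v u alpha _; apply: wp_ret. Qed.

Definition retrieve_all (X : finType) (xs : seq X) : flowchart Sigma k X unit :=
  in_sequence h (fun x => act (Retrieve _ _ x)) xs.

Lemma wp_retrieve_all (X : finType) (xs : seq X) (t : tree rank) u (beta alpha : seq (X * node t)) Q :
  unzip1 beta = xs -> Q tt (u, alpha) -> wp (retrieve_all xs) (u, beta ++ alpha) Q.
Proof.
elim: xs beta => [|x xs IH] [|[y w] beta] //=; first by move=> _; apply: wp_ret.
move=> [-> E] HQ; apply/wp_bind/(@wp_act _ _ _ _ _ _ _ (u, beta ++ alpha)).
  by split=> //; exists w.
exact: IH.
Qed.

Definition seek_all (X : finType) (y : 'I_k -> X) : flowchart Sigma k X unit :=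
  in_sequence h (fun i => seek rank h i (y i)) (enum 'I_k).

Lemma wp_seek_all (X : finType) (V : eqType) (f : 'I_k -> V) (rho : V -> X) fr (t : tree rank)
    (v : V -> node t) u alpha Q :
  represents rho fr v alpha -> Q tt (mktuple (fun i => v (f i)), alpha) ->
  wp (seek_all (fun i => rho (f i))) (u, alpha) Q.
Proof.
move=> Hr HQ; rewrite /seek_all.
have: forall i, i \notin enum 'I_k -> tnth u i = v (f i) by move=> i; rewrite mem_enum.
elim: (enum _) u => [|i s IH] u Hu /=.
  apply: wp_ret; rewrite (_ : u = mktuple (fun i => v (f i))) //.
  by apply: eq_from_tnth => i; rewrite tnth_mktuple Hu.
apply/wp_bind/(wp_seek_var Hr)/IH => j Hj; rewrite tnth_move_head.
by case: eqP => [->|/eqP ne] //; apply: Hu; rewrite in_cons negb_or ne.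
Qed.

(** On success the pebbles marking the witness stay on the stack, so that the caller can still send
    heads to them; [rho'] tells which pebble marks which variable. *)
Definition searcher (X : finType) (V : eqType) (P : predicate V) (js : seq V)
    (rho : V -> X) (fr : seq X) (F : flowchart Sigma k X bool) (rho' : V -> X) : Prop :=
  forall t v u alpha, represents rho fr v alpha ->
    wp F (u, alpha) (fun b (c : config k X t) =>
      if b then exists v' beta,
        [/\ agree_off js v' v, P t v', represents rho' [::] v' c.2,
            c.2 = beta ++ alpha & unzip1 beta = rev (take (size js) fr)]
      else c.2 = alpha /\ forall v', agree_off js v' v -> ~ P t v').

Lemma search_exists (V : eqType) (P : predicate V) (js : seq V) n :
  (forall (X : finType) (rho : V -> X) (fr : seq X),
    uniq fr -> n <= size fr -> exists F, decider P rho fr F) ->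
  forall (X : finType) (rho : V -> X) (fr : seq X),
    uniq fr -> n + size js <= size fr -> exists F rho', searcher P js rho fr F rho'.
Proof.
move=> HP X; elim: js => [|j js IH] rho fr Hu Hn.
  have [|F HF] := HP X rho fr Hu; first by rewrite addn0 in Hn.
  exists F, rho => t v u alpha Hr; apply: wp_mono (HF t v u alpha Hr) _.
  move=> b [u' alpha'] /= [-> Hb]; case: b Hb => Hb.
    exists v, [::]; rewrite take0; split=> //; first by apply/Hb.
    exact: represents_sub Hr.
  split=> // v' Hv'; rewrite (_ : v' = v); last by apply: functional_extensionality => z; apply: Hv'.
  by move/Hb.
case: fr Hu Hn => [|x fr] Hu Hn; first by rewrite addnS in Hn.
have Hu' : uniq fr by case/andP: Hu.
have [|F [rho' HF]] := IH (override rho j x) fr Hu'; first by move: Hn; rewrite /=; lia.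
pose body (_ : unit) : flowchart Sigma k X (unit + bool)%type :=
  bind (act (Drop _ h x)) (fun _ => bind F (fun b =>
    if b then ret h (inr true)
    (* [F] may have moved the head, so the current node of the loop is remembered only by the pebble
       [x], which is sought before it is taken away. *)
    else bind (seek rank h h x) (fun _ => bind (act (Retrieve _ _ x)) (fun _ =>
      bind (next_node rank h h) (fun b => ret h (if b then inl tt else inr false)))))).
exists (bind (goto_root h h) (fun _ => iterate body tt)), rho' => t v u alpha Hr.
apply/wp_bind/wp_goto_root.
(* The loop invariant, trivial at the start: values of [j] outside the list of remaining nodes have
   been refuted. *)
have : forall v', agree_off (j :: js) v' v -> v' j \notin nodes t -> ~ P t v'.
  by move=> v' _; rewrite mem_nodes.
have := suffix_from_root t.
elim: (nodes t) (tree_root t) u => [//|y l IHl] r u Hs Hl.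
have [l' [Er _] _] := suffix_from_cons Hs; rewrite Er in Hl Hs => {y l' Er}.
apply/wp_iterate/wp_bind/(wp_act (xexec_drop _ _ Hr)); rewrite tnth_move_head eqxx.
have Hr' := represents_push j r Hu Hr.
apply/wp_bind/(wp_mono (HF _ _ _ _ Hr')) => -[|] [u' alpha'] /=.
  move=> [v' [beta [Hv' HPv' Hr'' E1 E2]]]; apply: wp_ret.
  exists v', (rcons beta (x, r)); split=> //.
  - move=> z; rewrite in_cons negb_or => /andP[ne Hz].
    by rewrite Hv' // /override (negbTE ne).
  - by rewrite E1 cat_rcons.
  - by rewrite /unzip1 map_rcons -/unzip1 -/(unzip1 beta) E2 /= rev_cons.
move=> [-> HnP].
have [Hu1 _ _] := Hr'.
apply/wp_bind/(@wp_seek _ _ _ _ _ _ _ _ r); first by rewrite mem_head.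
  by move=> w' Hw'; apply: stack_fun Hu1 Hw' _; rewrite mem_head.
apply/wp_bind/(@wp_act _ _ _ _ _ _ _ (move_head u' h r, alpha)).
  by split=> //; exists r.
have Hl' v' : agree_off (j :: js) v' v -> v' j \notin l -> ~ P t v'.
  move=> Hv' Hj; case: (eqVneq (v' j) r) => [E|ne].
    apply: HnP => z Hz; rewrite /override; case: (eqVneq z j) => [->//|ne].
    by apply: Hv'; rewrite in_cons negb_or ne.
  by apply: Hl => //; rewrite in_cons negb_or ne.
apply/wp_bind/(wp_next_node_suffix _ _ Hs); first by rewrite tnth_move_head eqxx.
  move=> y Hy; apply: wp_ret; rewrite move_head_twice; exact: IHl.
move=> El w; apply: wp_ret; split=> // v' Hv'.
by apply: Hl' => //; rewrite El.
Qed.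

Lemma decidable_exists_list (V : eqType) (P : predicate V) (js : seq V) :
  pebble_decidable P ->
  pebble_decidable (fun t v => exists2 v', agree_off js v' v & P t v').
Proof.
move=> [n /search_exists HP]; exists (n + size js) => X rho fr Hu Hn.
have [F [rho' HF]] := HP js X rho fr Hu Hn.
exists (bind F (fun b => if b then
    bind (retrieve_all (rev (take (size js) fr))) (fun _ => ret h true)
  else ret h false)) => t v u alpha Hr.
apply/wp_bind/(wp_mono (HF _ _ _ _ Hr)) => -[|] [u' alpha'] /=.
  move=> [v' [beta [Hv' HPv' _ -> Eb]]].
  apply/wp_bind/(wp_retrieve_all Eb)/wp_ret; split=> //.
  by split=> // _; exists v'.
by move=> [-> H]; apply: wp_ret; split=> //; split=> // -[v' /H].
Qed.

Definition extend (V T : Type) (v : V -> T) (w : 'I_k -> T) (z : V + 'I_k) : T :=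
  match z with inl z => v z | inr i => w i end.

Lemma agree_off_extend (V : eqType) T (v : V + 'I_k -> T) v' :
  agree_off [seq inr i | i <- enum 'I_k] v' v <->
  exists w : 'I_k -> T, v' = extend (fun z => v (inl z)) w.
Proof.
split=> [H|[w ->] [z //|i]]; last by rewrite map_f // mem_enum.
exists (fun i => v' (inr i)); apply: functional_extensionality => -[z|i] //=.
by apply: H; apply/mapP => -[].
Qed.

Lemma decidable_exists (V : eqType) (z0 : V) (P : predicate (V + 'I_k)%type) :
  pebble_decidable P ->
  pebble_decidable (fun t v => exists w : k.-tuple (node t), P t (extend v (tnth w))).
Proof.
move/(decidable_exists_list [seq inr i | i <- enum 'I_k]).
(* Until the search assigns them, the new variables borrow the pebble of [z0]. *)
move/(decidable_reindex (fun z => match z with inl z => z | inr _ => z0 end)).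
apply: decidable_ext => t v; split.
  move=> [v' /agree_off_extend[w ->] HP]; exists (mktuple w).
  rewrite (_ : tnth (mktuple w) = w) //; apply: functional_extensionality => i.
  by rewrite tnth_mktuple.
move=> [w HP]; exists (extend v (tnth w)) => //.
by apply/agree_off_extend; exists (tnth w).
Qed.

(** This saves the tuple under the heads as values of variables, which frees the heads for a
    search. *)
Lemma drop_all_exists (X : finType) (V : eqType) (rho : V + 'I_k -> X) (fr : seq X) (s : seq 'I_k) :
  uniq fr -> size s <= size fr ->
  exists F rho', forall t (v : V + 'I_k -> node t) u alpha Q,
    represents rho fr v alpha ->
    (forall v' beta, represents rho' (drop (size s) fr) v' (beta ++ alpha) ->
      unzip1 beta = rev (take (size s) fr) ->
      (forall z, v' (inl z) = v (inl z)) ->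
      (forall i, i \in s -> v' (inr i) = tnth u i) ->
      (forall i, i \notin s -> v' (inr i) = v (inr i)) ->
      Q tt (u, beta ++ alpha)) ->
    wp (E := unit) F (u, alpha) Q.
Proof.
elim: s rho fr => [|i s IH] rho [|x fr] Hu Hn //=.
  exists (ret h tt), rho => t v u alpha Q Hr HQ; apply: wp_ret.
  by apply: (HQ v [::]).
  exists (ret h tt), rho => t v u alpha Q Hr HQ; apply: wp_ret.
  by apply: (HQ v [::]).
have [F [rho' HF]] := IH (override rho (inr i) x) fr ltac:(by case/andP: Hu) Hn.
exists (bind (act (Drop _ i x)) (fun _ => F)), rho' => t v u alpha Q Hr HQ.
apply/wp_bind/(wp_act (xexec_drop u i Hr))/(HF _ _ _ _ _ (represents_push (inr i) (tnth u i) Hu Hr)).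
move=> v' beta Hr' Eb H1 H2 H3; rewrite -cat_rcons; apply: (HQ v') => //.
- by rewrite cat_rcons.
- by rewrite /unzip1 map_rcons -/(unzip1 beta) Eb rev_cons.
- move=> j; rewrite in_cons; case: (boolP (j \in s)) => [Hj _|Hj]; first exact: H2.
  by rewrite orbF => /eqP E; subst j; rewrite H3 // /override eqxx.
- move=> j; rewrite in_cons negb_or => /andP[ne Hj].
  by rewrite H3 // /override; case: eqP => // -[E]; rewrite E eqxx in ne.
Qed.

(** One move in a walk on tuples: the heads hold the current tuple and exchange it for a related
    one. On failure they return to it, since the walk then tries another relation from the same
    tuple. *)
Definition finder (X : finType) (V : eqType) (P : predicate (V + 'I_k + 'I_k)%type)
    (rho : V -> X) (fr : seq X) (F : flowchart Sigma k X bool) : Prop :=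
  forall t v u alpha, represents rho fr v alpha ->
    wp F (u, alpha) (fun b (c : config k X t) => c.2 = alpha /\
      if b then P t (extend (extend v (tnth u)) (tnth c.1))
      else c.1 = u /\ forall w : k.-tuple (node t), ~ P t (extend (extend v (tnth u)) (tnth w))).

Lemma finder_exists (V : eqType) (z0 : V) (P : predicate (V + 'I_k + 'I_k)%type) :
  pebble_decidable P ->
  exists n, forall (X : finType) (rho : V -> X) (fr : seq X),
    uniq fr -> n <= size fr -> exists F, finder P rho fr F.
Proof.
(* [k] pebbles save the current tuple, [k] mark the candidate, and [n] serve to evaluate [P]. *)
move=> [n /search_exists HP]; exists (n + k + k) => X rho fr Hu Hn.
have [|F1 [rho1 HF1]] := @drop_all_exists X V (extend rho (fun _ => rho z0)) fr (enum 'I_k) Hu.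
  by rewrite size_enum_ord; lia.
rewrite size_enum_ord in HF1.
have [||F2 [rho2 HF2]] := HP [seq inr i | i <- enum 'I_k] X
    (extend rho1 (fun _ => rho1 (inl z0))) (drop k fr).
- exact: drop_uniq.
- by rewrite size_map size_enum_ord size_drop; lia.
exists (bind F1 (fun _ => bind F2 (fun b =>
  if b then
    bind (seek_all (fun i => rho2 (inr i))) (fun _ =>
    bind (retrieve_all (rev (take k (drop k fr)))) (fun _ =>
    bind (retrieve_all (rev (take k fr))) (fun _ => ret h true)))
  else
    bind (seek_all (fun i => rho1 (inr i))) (fun _ =>
    bind (retrieve_all (rev (take k fr))) (fun _ => ret h false))))).
move=> t v u alpha Hr.
apply/wp_bind/(HF1 _ (extend v (fun _ => v z0))).
  by case: Hr => Hr1 Hr2 Hr3; split=> // -[z|i] /=.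
move=> v1 beta1 Hr1 Eb1 H1 H1' _.
have {H1 H1'} Ev1 : v1 = extend v (tnth u).
  by apply: functional_extensionality => -[z|i] /=; rewrite ?H1 ?H1' ?mem_enum.
subst v1; apply/wp_bind/wp_mono.
  apply: (HF2 _ (extend (extend v (tnth u)) (fun _ => v z0))).
  by case: Hr1 => Hr1 Hr2 Hr3; split=> // -[z|i] //=; apply: (Hr2 (inl z0)).
move=> [|] [u2 alpha2] /=.
  move=> [v2 [beta2 [/agree_off_extend[w ->] HPw Hr2 E2 Eb2]]]; subst alpha2.
  apply/wp_bind/(wp_seek_all (f := fun i => inr i) _ Hr2) => /=.
  rewrite size_map size_enum_ord in Eb2.
  apply/wp_bind/(wp_retrieve_all Eb2)/wp_bind/(wp_retrieve_all Eb1)/wp_ret; split=> //=.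
  rewrite (_ : tnth [tuple w i | i < k] = w) //.
  by apply: functional_extensionality => i; rewrite tnth_mktuple.
move=> [-> HnP]; apply/wp_bind/(wp_seek_all (f := fun i => inr i) _ Hr1) => /=.
apply/wp_bind/(wp_retrieve_all Eb1)/wp_ret; split=> //=; split.
  by apply: eq_from_tnth => i; rewrite tnth_mktuple.
by move=> w; apply: HnP; apply/agree_off_extend; exists (tnth w).
Qed.

End Decidability.

(** * Backward depth-first search in a functional graph *)

Section DepthFirst.
Variables (T : finType) (e lt : rel T) (a b : T).
Hypothesis e_fun : forall x y z, e x y -> e x z -> y = z.
Hypothesis e_sink : forall x, ~~ e b x.
Hypothesis lt_irr : irreflexive lt.
Hypothesis lt_trans : transitive lt.
Hypothesis lt_total : forall x y, x != y -> lt x y || lt y x.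

Definition first_child c w := e w c /\ ~ exists w', e w' c /\ lt w' w.

Definition next_sibling c w :=
  exists p, [/\ e c p, e w p, lt c w & ~ exists w', [/\ e w' p, lt c w' & lt w' w]].

(** [good c m r] is to be read: the search at [c] in mode [m] ends with the answer [r]. Mode [true]
    enters the subtree of [c], mode [false] leaves it after an unsuccessful visit. The hypotheses
    are the moves of the search, read backwards from the answer. *)
Variable good : T -> bool -> bool -> Prop.
Hypothesis good_found : good a true true.
Hypothesis good_first : forall c r, c != a -> (exists w, first_child c w) ->
  (forall w, first_child c w -> good w true r) -> good c true r.
Hypothesis good_leaf : forall c r, c != a -> ~ (exists w, first_child c w) ->
  good c false r -> good c true r.
Hypothesis good_end : good b false false.
Hypothesis good_next : forall c r, c != b -> (exists w, next_sibling c w) ->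
  (forall w, next_sibling c w -> good w true r) -> good c false r.
Hypothesis good_parent : forall c r, c != b -> ~ (exists w, next_sibling c w) ->
  (exists p, e c p) -> (forall p, e c p -> good p false r) -> good c false r.

Lemma minimal_exists (P : pred T) x :
  P x -> exists2 m, P m & ~ exists w', P w' /\ lt w' m.
Proof.
move=> Px; case: (arg_minnP (fun x => #|[set y | lt y x]|) Px) => m Pm Hm.
exists m => // -[w' [Pw' Hlt]]; have := Hm _ Pw'; rewrite leqNgt => /negP[].
apply: proper_card; apply/properP; split.
  by apply/subsetP => y; rewrite !inE => /lt_trans; apply.
by exists w'; rewrite inE // lt_irr.
Qed.

(** A cycle through [c] would pass along the unique path from [c] to [b], but no edge leaves [b].
    Hence the subtree of a predecessor is strictly smaller, which makes the induction below
    well-founded. *)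
Lemma no_cycle w c : e w c -> connect e c b -> ~~ connect e c w.
Proof.
move=> Hwc /connectP[p Hp Eb]; apply/negP => Hcw.
have: exists2 y, e c y & connect e y c.
  case/connectP: Hcw => -[|y q] /=; first by move=> _ E; exists c; rewrite ?connect0 // -{1}E.
  move=> /andP[Hy Hq] E; exists y => //; apply: connect_trans (connect1 Hwc).
  by apply/connectP; exists q.
elim: p {Hwc Hcw} c Hp Eb => [|d p IH] c /=.
  by move=> _ <- [y Hy]; rewrite (negbTE (e_sink y)) in Hy.
move=> /andP[Hcd Hp] Eb [y Hcy Hy]; apply: (IH d Hp Eb).
have Ed := e_fun Hcd Hcy; subst y; case/connectP: Hy => -[|z q] /=.
  by move=> _ E; exists d; rewrite ?connect0 // -{1}E.
move=> /andP[Hz Hq] E; exists z => //; apply: connect_trans (connect1 Hcd).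
by apply/connectP; exists q.
Qed.

Lemma connect_child x c :
  x != c -> connect e x c -> exists2 w, e w c & connect e x w.
Proof.
move=> ne /connectP[p]; case/lastP: p => [|p y] /=; first by move=> _ E; rewrite E eqxx in ne.
rewrite rcons_path last_rcons => /andP[Hp He] ->; exists (last x p) => //.
by apply/connectP; exists p.
Qed.

(** Stated with a continuation: if the source lies below [c], entering [c] succeeds, and otherwise
    entering [c] gives whatever leaving [c] gives. The outer induction is on the number of elements
    below [c]. *)
Lemma subtree_visited c : connect e c b ->
  if connect e a c then good c true true
  else forall r, good c false r -> good c true r.
Proof.
have [n] := ubnP #|[set x | connect e x c]|.
elim: n c => // n IH c Hn Hcb.
case: (eqVneq c a) => [->|ne]; first by rewrite connect0.
have IHc w : e w c -> if connect e a w then good w true true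
    else forall r, good w false r -> good w true r.
  move=> Hw; apply: IH (connect_trans (connect1 Hw) Hcb).
  apply: leq_trans _ (ltnSE Hn); apply: proper_card; apply/properP; split.
    by apply/subsetP => x; rewrite !inE => /connect_trans; apply; apply: connect1.
  by exists c; rewrite inE ?connect0 // no_cycle.
(* The same claim for [w] together with its later siblings, by an inner induction on the number of
   elements after [w]; leaving the last sibling means leaving the parent [c]. *)
have Hsib w : e w c ->
    if [exists w', [&& e w' c, (w' == w) || lt w w' & connect e a w']]
    then good w true true else forall r, good c false r -> good w true r.
  have [m] := ubnP #|[set w' | lt w w']|; elim: m w => // m IHm w Hm Hw.
  have Hwb : w != b by apply: contraTneq Hw => ->; apply: e_sink.
  have := IHc w Hw; case: (boolP (connect e a w)) => [Haw|Haw] Hgood.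
    suff -> : [exists w', [&& e w' c, (w' == w) || lt w w' & connect e a w']] = true by [].
    by apply/existsP; exists w; rewrite Hw eqxx.
  have [Hnext|Hnext] := classic (exists w', next_sibling w w').
    have Hw' w' : next_sibling w w' -> 
      if [exists w', [&& e w' c, (w' == w) || lt w w' & connect e a w']]
      then good w' true true else forall r, good c false r -> good w' true r.
      move=> [p [Hwp Hw'p Hlt Hmin]]; have Ep := e_fun Hwp Hw; subst p.
      (* The source is not below [w], and no sibling lies strictly between [w] and [w']. *)
      have -> : [exists x, [&& e x c, (x == w) || lt w x & connect e a x]] =
                [exists x, [&& e x c, (x == w') || lt w' x & connect e a x]].
        apply: eq_existsb => x; case Hx: (e x c) => //=; case Hax: (connect e a x); rewrite ?andbF ?andbT //.
        have -> : (x == w) = false by apply: contraNF Haw => /eqP <-.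
        case: (eqVneq x w') => [->|nx] //=.
        apply/idP/idP => [Hwx|]; last exact: lt_trans.
        case/orP: (lt_total nx) => // Hx'; case: Hmin; by exists x.
      apply: IHm => //; apply: leq_trans _ (ltnSE Hm).
      apply: proper_card; apply/properP; split.
        by apply/subsetP => x; rewrite !inE; apply: lt_trans.
      by exists w'; rewrite inE // lt_irr.
    case: ifP Hw' => _ Hw'; first by apply/Hgood/good_next => // w' /Hw'.
    by move=> r Hr; apply/Hgood/good_next => // w' /Hw'; apply.
  have Hlast w' : e w' c -> lt w w' -> False.
    move=> H1 H2; have [|x /andP[Hx1 Hx2] Hmin] := @minimal_exists (fun x => e x c && lt w x) w'.
      by rewrite H1.
    case: Hnext; exists x, c; split=> // -[y [Hy1 Hy2 Hy3]]; apply: Hmin.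
    by exists y; rewrite Hy1.
  have -> : [exists w', [&& e w' c, (w' == w) || lt w w' & connect e a w']] = false.
    apply/negbTE/negP => /existsP[w' /and3P[H1 /orP[/eqP E|H2] H3]].
      by rewrite -E H3 in Haw.
    exact: Hlast H1 H2.
  move=> r Hr; apply/Hgood/good_parent => //; first by exists c.
  by move=> p Hp; rewrite (e_fun Hp Hw).
have [Hfirst|Hfirst] := classic (exists w, first_child c w).
  have Hw w : first_child c w -> if connect e a c then good w true true
      else forall r, good c false r -> good w true r.
    move=> [Hwc Hmin].
    have -> : connect e a c = [exists w', [&& e w' c, (w' == w) || lt w w' & connect e a w']].
      apply/idP/existsP => [|[w' /and3P[H1 _ H2]]]; last exact: connect_trans H2 (connect1 H1).
      case/connect_child; first by rewrite eq_sym.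
      move=> w' H1 H2; exists w'; rewrite H1 H2 andbT /=.
      case: (eqVneq w' w) => // nw; case/orP: (lt_total nw) => // H3.
      by case: Hmin; exists w'.
    exact: Hsib.
  case: ifP Hw => _ Hw; first by apply: good_first => // w /Hw.
  by move=> r Hr; apply: good_first => // w /Hw; apply.
have -> : connect e a c = false.
  apply/negbTE/negP => /connect_child[|w Hw _]; first by rewrite eq_sym.
  have [x Hx Hmin] := @minimal_exists (fun x => e x c) w Hw.
  by case: Hfirst; exists x.
by move=> r; apply: good_leaf.
Qed.

(** Leaving the root [b] answers [false] by [good_end], which settles the case where the source is
    not below [b]. *)
Lemma depth_first_search : good b true (connect e a b).
Proof.
have := subtree_visited (connect0 e b); case: (connect e a b) => //; exact.
Qed.

End DepthFirst.

(** * Atomic formulas and a linear order on tuples *)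

Section FormulasToAutomata.
Variables (Sigma : finType) (rank : Sigma -> nat) (k : nat) (hk : 0 < k).

Let h : 'I_k := Ordinal hk.
Local Notation predicate := (predicate rank).
Local Notation pebble_decidable := (@pebble_decidable Sigma rank k).

Lemma decidable_or (V : eqType) (P P' : predicate V) :
  pebble_decidable P -> pebble_decidable P' ->
  pebble_decidable (fun t v => P t v \/ P' t v).
Proof.
move=> /(decidable_not hk) H /(decidable_not hk) H'.
apply: decidable_ext (decidable_not hk (decidable_and hk H H')) => t v.
by have := classic (P t v); have := classic (P' t v); tauto.
Qed.

Lemma decidable_label (V : eqType) s (z : V) :
  pebble_decidable (fun t v => has_label s (v z)).
Proof.
exists 0 => X rho fr _ _; exists (bind (seek rank h h (rho z)) (fun _ => check (TLab X h s))).
move=> t v u alpha Hr; apply/wp_bind/(wp_seek_var _ Hr)/wp_check; rewrite /xholds /= tnth_move_head eqxx => H.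
  by split.
by split.
Qed.

Lemma decidable_eq (V : eqType) (x y : V) : pebble_decidable (fun t v => v x = v y).
Proof.
exists 0 => X rho fr _ _; exists (bind (seek rank h h (rho x)) (fun _ => check (TPeb _ h (rho y)))).
move=> t v u alpha Hr; apply/wp_bind/(wp_seek_var _ Hr)/(wp_check_var Hr) => /=.
by rewrite tnth_move_head eqxx; split=> //; split=> /eqP.
Qed.

Lemma decidable_edge (V : eqType) i (x y : V) :
  pebble_decidable (fun t v => is_child i (v x) (v y)).
Proof.
exists 0 => X rho fr _ _; exists (bind (seek rank h h (rho y)) (fun _ =>
  bind (check (TChno _ _ h i)) (fun b =>
    (* Child number 0 is that of the root, where [Up] is impossible and the flowchart would be
       stuck. *)
    if b && (0 < i) then bind (act (Up _ _ h)) (fun _ => check (TPeb _ h (rho x)))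
    else ret h false))).
move=> t v u alpha Hr; apply/wp_bind/(wp_seek_var _ Hr)/wp_bind/wp_check;
  rewrite /xholds /= tnth_move_head eqxx; last first.
  by move=> H; apply: wp_ret; split=> //; split=> // /is_child_number.
move=> E; case: ifP => Hi; last first.
  apply: wp_ret; split=> //; split=> // /is_child_bounds.
  by rewrite Hi.
case: (root_or_child (v y)) => [/child_number0 E0|[w]]; first by rewrite -E E0 in Hi.
rewrite E => Hw; apply/wp_bind/wp_act.
  by apply: (@xexec_up _ _ _ _ _ _ _ _ w i); rewrite tnth_move_head eqxx.
apply: (wp_check_var Hr); split=> //; rewrite !tnth_move_head eqxx.
split=> [/eqP <- //|H]; by have [-> _] := is_child_inj H Hw.
Qed.

Lemma decidable_ancestor (V : eqType) (x y : V) :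
  pebble_decidable (fun t v => ancestor (v x) (v y)).
Proof.
exists 0 => X rho fr _ _; exists (bind (seek rank h h (rho y)) (fun _ =>
  iterate (fun _ : unit => bind (check (TPeb _ h (rho x))) (fun b =>
    if b then ret h (inr true)
    else bind (check (TChno _ _ h 0)) (fun b =>
      if b then ret h (inr false)
      else bind (act (Up _ _ h)) (fun _ => ret h (inl tt))))) tt)).
move=> t v u alpha Hr; apply/wp_bind/(wp_seek_var _ Hr).
have [n] := ubnP (size (addr (v y))); elim: n (v y) => // n IH z Hn.
apply/wp_iterate/wp_bind/(wp_check_var Hr); rewrite tnth_move_head eqxx.
case: eqP => [->|ne].
  by apply: wp_ret; split=> //; split=> // _; apply: prefix_refl.
apply/wp_bind/wp_check; rewrite /xholds /= tnth_move_head eqxx.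
  move/child_number0 => E; apply: wp_ret; split=> //; split=> //.
  by rewrite /ancestor E prefixs0 => /eqP H; case: ne; apply: node_inj; rewrite E H.
move=> H0; case: (root_or_child z) => [/child_number0 //|[w Hw]].
apply/wp_bind/wp_act.
  by apply: (@xexec_up _ _ _ _ _ _ _ _ w (child_number z)); rewrite tnth_move_head eqxx.
rewrite move_head_twice; apply/wp_ret.
have Hw' : size (addr w) < n by move: Hn; rewrite (eqP Hw) size_rcons.
apply: wp_mono (IH w Hw') _ => b c [-> ->]; split=> //.
by rewrite (ancestor_parent _ Hw) (introF eqP) //=; apply: nesym.
Qed.

Definition position (t : tree rank) (x : node t) : nat := index x (nodes t).

Lemma position_inj (t : tree rank) : injective (@position t).
Proof.
move=> x y E; apply: (index_inj x (mem_nodes x) (mem_nodes y) E).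
Qed.

(** A scan from the root stops at whichever pebble it meets first; [y] is tested before [x], so that
    equal nodes give [false]. *)
Lemma decidable_before (V : eqType) (x y : V) :
  pebble_decidable (fun t v => position (v x) < position (v y)).
Proof.
exists 0 => X rho fr _ _; exists (bind (goto_root h h) (fun _ =>
  iterate (fun _ : unit => bind (check (TPeb _ h (rho y))) (fun b =>
    if b then ret h (inr false)
    else bind (check (TPeb _ h (rho x))) (fun b =>
      if b then ret h (inr true)
      else bind (next_node rank h h) (fun _ => ret h (inl tt))))) tt)).
move=> t v u alpha Hr; apply/wp_bind/wp_goto_root; rewrite /position.
have := suffix_from_root t; have := mem_nodes (v x); have := mem_nodes (v y).
elim: (nodes t) (tree_root t) => [//|z l IH] r Hy Hx Hs.
have [l' [Er _] _] := suffix_from_cons Hs; rewrite Er in Hx Hy Hs * => {z l' Er}.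
apply/wp_iterate/wp_bind/(wp_check_var Hr); rewrite tnth_move_head eqxx.
case: (eqVneq r (v y)) => [->|ney].
  by apply: wp_ret; split=> //; rewrite /= eqxx.
apply/wp_bind/(wp_check_var Hr); rewrite tnth_move_head eqxx.
case: (eqVneq r (v x)) => [<-|nex].
  by apply: wp_ret; split=> //; rewrite /= eqxx (negbTE ney).
apply/wp_bind/(wp_next_node_suffix _ _ Hs); first by rewrite tnth_move_head eqxx.
  move=> z Hz; apply: wp_ret; rewrite move_head_twice /= (negbTE nex) (negbTE ney) ltnS.
  apply: IH => //.
    by move: Hy; rewrite in_cons eq_sym (negbTE ney).
  by move: Hx; rewrite in_cons eq_sym (negbTE nex).
by move=> El; move: Hx; rewrite El inE eq_sym (negbTE nex).
Qed.

Fixpoint lex (s : seq 'I_k) (f g : 'I_k -> nat) : bool :=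
  if s is i :: s' then (f i < g i) || (f i == g i) && lex s' f g else false.

(** Lexicographic order over preorder positions. Its role is to order the predecessors of a tuple,
    so that first child and next sibling make sense in the search tree. *)
Definition tuple_before (t : tree rank) (f g : 'I_k -> node t) : bool :=
  lex (enum 'I_k) (fun i => position (f i)) (fun i => position (g i)).

Lemma lex_irr s f : lex s f f = false.
Proof. by elim: s => //= i s ->; rewrite ltnn andbF. Qed.

Lemma lex_trans s f g f' : lex s f g -> lex s g f' -> lex s f f'.
Proof.
elim: s => //= i s IH /orP[H1|/andP[/eqP H1 H2]] /orP[H3|/andP[/eqP H3 H4]].
- by rewrite (ltn_trans H1 H3).
- by rewrite -H3 H1.
- by rewrite H1 H3.
- by rewrite H1 H3 eqxx IH ?orbT.
Qed.

Lemma lex_total s f g : [\/ lex s f g, lex s g f | forall i, i \in s -> f i = g i].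
Proof.
elim: s => [|i s IH] /=; first by apply: Or33.
case: (ltngtP (f i) (g i)) => [H|H|E] /=; [exact: Or31|exact: Or32|].
case: IH => [H|H|H]; [by apply: Or31|by apply: Or32|apply: Or33].
by move=> j; rewrite in_cons => /predU1P[->|/H].
Qed.

Lemma decidable_tuple_before (V : eqType) (f g : 'I_k -> V) :
  pebble_decidable (fun t v => tuple_before (fun i => v (f i)) (fun i => v (g i))).
Proof.
rewrite /tuple_before; elim: (enum _) => [|i s IH] /=.
  by apply: decidable_ext (decidable_not hk (decidable_true rank hk V)) => t v; split=> // -[].
apply: decidable_ext (decidable_or (decidable_before (f i) (g i))
    (decidable_and hk (decidable_eq (f i) (g i)) IH)) => t v.
split=> [[->//|[-> ->]]|/orP[|/andP[/eqP/position_inj E H]]]; first by rewrite eqxx orbT.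
  by left.
by right.
Qed.

Lemma decidable_tuple_eq (V : eqType) (f g : 'I_k -> V) :
  pebble_decidable (fun t v => forall i, v (f i) = v (g i)).
Proof.
suff H (s : seq 'I_k) : pebble_decidable (fun t (v : V -> node t) => forall i, i \in s -> v (f i) = v (g i)).
  by apply: decidable_ext (H (enum 'I_k)) => t v; split=> H' i *; apply: H'; rewrite ?mem_enum.
elim: s => [|i s IH]; first by apply: decidable_ext (decidable_true rank hk V) => t v.
apply: decidable_ext (decidable_and hk (decidable_eq (f i) (g i)) IH) => t v.
split=> [[H1 H2] j|H]; first by rewrite in_cons => /predU1P[->|/H2].
by split=> [|j Hj]; apply: H; rewrite in_cons ?eqxx // Hj orbT.
Qed.

End FormulasToAutomata.

(** * Deterministic transitive closure *)

Section DTC.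
Variables (Sigma : finType) (rank : Sigma -> nat) (k : nat) (hk : 0 < k).

Let h : 'I_k := Ordinal hk.
Local Notation pebble_decidable := (@pebble_decidable Sigma rank k).

(** The arguments are functions on ['I_k] rather than tuples, so that variables are put in by
    composition. *)
Definition tuple_relation (V : Type) : Type :=
  forall t : tree rank, (V -> node t) -> ('I_k -> node t) -> ('I_k -> node t) -> Prop.

(** Decidability in every context [V'], so that [R] can be used under quantifiers and with its
    arguments exchanged; [z0] is the inhabitant that [decidable_exists] asks for. *)
Definition relation_decidable (V : eqType) (R : tuple_relation V) : Prop :=
  forall (V' : eqType) (z0 : V') (e : V -> V') (f g : 'I_k -> V'),
    pebble_decidable (fun t v => R t (fun z => v (e z)) (fun i => v (f i)) (fun i => v (g i))).

Lemma relation_decidable_extend (V : eqType) (R : tuple_relation V) :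
  pebble_decidable (fun t (v : V + 'I_k + 'I_k -> node t) =>
    R t (fun z => v (inl (inl z))) (fun i => v (inl (inr i))) (fun i => v (inr i))) ->
  relation_decidable R.
Proof. by move=> H V' _ e f g; exact: (decidable_reindex (extend (extend e f) g) H). Qed.

Lemma relation_decidable_finder (V : eqType) (z0 : V) (R : tuple_relation V) :
  relation_decidable R ->
  exists n, forall (X : finType) (rho : V -> X) (fr : seq X),
    uniq fr -> n <= size fr -> exists F, forall t v u alpha, represents rho fr v alpha ->
    wp F (u, alpha) (fun b (c : config k X t) => c.2 = alpha /\
      if b then R t v (tnth u) (tnth c.1)
      else c.1 = u /\ forall w : k.-tuple (node t), ~ R t v (tnth u) (tnth w)).
Proof.
move=> HR; exact: (finder_exists hk z0 (HR _ (inl (inl z0)) (fun z => inl (inl z)) (fun i => inl (inr i)) inr)).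
Qed.

Section Steps.
Variables (V : eqType) (R : tuple_relation V).

Let W : eqType := (V + 'I_k + 'I_k)%type.

(* In the context [W], the two blocks of variables are the source and the
   target of the closure. *)
Definition open_step : tuple_relation W := fun t v c w =>
  R (fun z => v (inl (inl z))) c w /\ ~ (forall i, c i = v (inr i)).

(** The search runs against the arrows: the children of [c] are its predecessors, and [w] is the
    least one. *)
Definition first_step : tuple_relation W := fun t v c w =>
  open_step v w c /\
  ~ exists w' : k.-tuple (node t), open_step v (tnth w') c /\ tuple_before (tnth w') w.

Definition next_step : tuple_relation W := fun t v c w =>
  exists p : k.-tuple (node t),
    [/\ open_step v c (tnth p), open_step v w (tnth p), tuple_before c w &
        ~ exists w' : k.-tuple (node t),
          [/\ open_step v (tnth w') (tnth p), tuple_before c (tnth w') &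
              tuple_before (tnth w') w]].

(** A test of the current tuple, given as a relation included in equality so that a finder can run
    it. *)
Definition at_source : tuple_relation W := fun t v c w =>
  (forall i, c i = w i) /\ (forall i, c i = v (inl (inr i))).

Definition at_target : tuple_relation W := fun t v c w =>
  (forall i, c i = w i) /\ (forall i, c i = v (inr i)).

Hypothesis HR : relation_decidable R.

Lemma open_step_decidable : relation_decidable open_step.
Proof.
move=> V' z0 e f g; apply: (decidable_and hk).
  exact: (HR z0 (fun z => e (inl (inl z))) f g).
exact: (decidable_not hk (decidable_tuple_eq rank hk f (fun i => e (inr i)))).
Qed.

Lemma first_step_decidable : relation_decidable first_step.
Proof.
move=> V' z0 e f g; apply: (decidable_and hk); first exact: (open_step_decidable z0 e g f).
apply: (decidable_not hk).
apply: (decidable_exists hk z0 (P := fun t (v : V' + 'I_k -> node t) =>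
  open_step (fun z => v (inl (e z))) (fun i => v (inr i)) (fun i => v (inl (f i))) /\
  tuple_before (fun i => v (inr i)) (fun i => v (inl (g i))))).
apply: (decidable_and hk); last exact: decidable_tuple_before.
exact: (open_step_decidable (inl z0) (fun z => inl (e z)) inr (fun i => inl (f i))).
Qed.

Lemma next_step_decidable : relation_decidable next_step.
Proof.
move=> V' z0 e f g.
have H : pebble_decidable (fun t (v : V' + 'I_k -> node t) =>
  open_step (fun z => v (inl (e z))) (fun i => v (inl (f i))) (fun i => v (inr i)) /\
  (open_step (fun z => v (inl (e z))) (fun i => v (inl (g i))) (fun i => v (inr i)) /\
  (tuple_before (fun i => v (inl (f i))) (fun i => v (inl (g i))) /\
  ~ exists w' : k.-tuple (node t),
    open_step (fun z => v (inl (e z))) (tnth w') (fun i => v (inr i)) /\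
    (tuple_before (fun i => v (inl (f i))) (tnth w') /\
     tuple_before (tnth w') (fun i => v (inl (g i))))))).
  apply: (decidable_and hk).
    exact: (open_step_decidable (inl z0) (fun z => inl (e z)) (fun i => inl (f i)) inr).
  apply: (decidable_and hk).
    exact: (open_step_decidable (inl z0) (fun z => inl (e z)) (fun i => inl (g i)) inr).
  apply: (decidable_and hk); first exact: decidable_tuple_before.
  apply: (decidable_not hk).
  apply: (decidable_exists hk (inl z0) (P := fun t (v : V' + 'I_k + 'I_k -> node t) =>
    open_step (fun z => v (inl (inl (e z)))) (fun i => v (inr i)) (fun i => v (inl (inr i))) /\
    (tuple_before (fun i => v (inl (inl (f i)))) (fun i => v (inr i)) /\
     tuple_before (fun i => v (inr i)) (fun i => v (inl (inl (g i))))))).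
  apply: (decidable_and hk).
    exact: (open_step_decidable (inl (inl z0)) (fun z => inl (inl (e z))) inr (fun i => inl (inr i))).
  apply: (decidable_and hk); exact: decidable_tuple_before.
apply: decidable_ext (decidable_exists hk z0 H) => t v.
split=> [[p [H1 [H2 [H3 H4]]]]|[p [H1 H2 H3 H4]]]; exists p.
  by split=> // -[w' [? ? ?]]; apply: H4; exists w'.
by do !split=> //; move=> [w' [? [? ?]]]; apply: H4; exists w'.
Qed.

Lemma at_source_decidable : relation_decidable at_source.
Proof.
by move=> V' z0 e f g; apply: (decidable_and hk); [exact: decidable_tuple_eq|
  exact: (decidable_tuple_eq rank hk f (fun i => e (inl (inr i))))].
Qed.

Lemma at_target_decidable : relation_decidable at_target.
Proof.
by move=> V' z0 e f g; apply: (decidable_and hk); [exact: decidable_tuple_eq|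
  exact: (decidable_tuple_eq rank hk f (fun i => e (inr i)))].
Qed.

End Steps.

Lemma tuple_before_total t (x y : k.-tuple (node t)) :
  x != y -> tuple_before (rank := rank) (tnth x) (tnth y) || tuple_before (tnth y) (tnth x).
Proof.
move=> ne; rewrite /tuple_before; case: (lex_total (enum 'I_k) (fun i => position (tnth x i)) (fun i => position (tnth y i))) => [->//|->|H].
  by rewrite orbT.
case/eqP: ne; apply: eq_from_tnth => i; apply: position_inj; apply: H.
by rewrite mem_enum.
Qed.

Lemma tnth_eq (T : Type) (x : k.-tuple T) (f : 'I_k -> T) :
  (forall i, tnth x i = f i) <-> x = mktuple f.
Proof.
split=> [H|-> i]; last by rewrite tnth_mktuple.
by apply: eq_from_tnth => i; rewrite H tnth_mktuple.
Qed.

Lemma decidable_dtc (V : eqType) (z0 : V) (R : tuple_relation V) :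
  relation_decidable R ->
  (forall t (v : V -> node t) (a b b' : k.-tuple (node t)),
     R t v (tnth a) (tnth b) -> R t v (tnth a) (tnth b') -> b = b') ->
  pebble_decidable (fun t (v : V + 'I_k + 'I_k -> node t) =>
    clos_refl_trans (k.-tuple (node t))
      (fun a b => R t (fun z => v (inl (inl z))) (tnth a) (tnth b))
      (mktuple (fun i => v (inl (inr i)))) (mktuple (fun i => v (inr i)))).
Proof.
move=> HR Rfun; pose w0 : V + 'I_k + 'I_k := inl (inl z0).
have [n1 H1] := relation_decidable_finder w0 (at_source_decidable (V := V)).
have [n2 H2] := relation_decidable_finder w0 (at_target_decidable (V := V)).
have [n3 H3] := relation_decidable_finder w0 (first_step_decidable HR).
have [n4 H4] := relation_decidable_finder w0 (next_step_decidable HR).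
have [n5 H5] := relation_decidable_finder w0 (open_step_decidable HR).
(* The five finders run one after the other on the same free pebbles; the sum is just a convenient
   upper bound. *)
exists (n1 + n2 + n3 + n4 + n5) => X rho fr Hu Hn.
have [|F1 {}H1] := H1 X rho fr Hu; first lia.
have [|F2 {}H2] := H2 X rho fr Hu; first lia.
have [|F3 {}H3] := H3 X rho fr Hu; first lia.
have [|F4 {}H4] := H4 X rho fr Hu; first lia.
have [|F5 {}H5] := H5 X rho fr Hu; first lia.
(* [inl] carries the next mode and [inr] the answer. After [F3], [inl b] enters the first child if
   there is one and otherwise leaves the current tuple, which the heads still hold. *)
pose body (down : bool) : flowchart Sigma k X (bool + bool)%type :=
  if down then
    bind F1 (fun b => if b then ret h (inr true)
      else bind F3 (fun b => ret h (inl b)))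
  else
    bind F2 (fun b => if b then ret h (inr false)
      else bind F4 (fun b => if b then ret h (inl true)
        else bind F5 (fun _ => ret h (inl false)))).
exists (bind (seek_all rank hk (fun i => rho (inr i))) (fun _ => iterate body true)).
move=> t v u alpha Hr; apply/wp_bind/(wp_seek_all (f := fun i => inr i) hk _ Hr).
set a := mktuple (fun i => v (inl (inr i))); set b := mktuple (fun i => v (inr i)).
(* Tuples of nodes form a finite type, so the relation has a boolean version by classical case
   analysis and finite choice, and [connect] applies. *)
have [e He] : exists e : rel (k.-tuple (node t)), forall c w,
    open_step R v (tnth c) (tnth w) <-> e c w.
  have [e He] : exists e : (k.-tuple (node t) * k.-tuple (node t))%type -> bool,
      forall p, open_step R v (tnth p.1) (tnth p.2) <-> e p.
    apply: (@fin_all_exists _ (fun _ => bool) (fun p b => open_step R v (tnth p.1) (tnth p.2) <-> b)).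
    move=> p; have [H|H] := classic (open_step R v (tnth p.1) (tnth p.2)).
      by exists true.
    by exists false.
  by exists (fun c w => e (c, w)) => c w; apply: (He (c, w)).
pose lt : rel (k.-tuple (node t)) := fun x y => tuple_before (tnth x) (tnth y).
have Efirst c w : first_step R v (tnth c) (tnth w) <-> first_child e lt c w.
  split=> -[/He Hwc Hmin]; split=> // -[w' [/He Hw' Hlt]]; apply: Hmin;
  by exists w'.
have Enext c w : next_step R v (tnth c) (tnth w) <-> next_sibling e lt c w.
  split=> -[p [/He Hcp /He Hwp Hlt Hmin]]; exists p; split=> // -[w' [/He ? ? ?]];
  by apply: Hmin; exists w'.
have Econn : connect e a b <-> clos_refl_trans (k.-tuple (node t))
      (fun a b => R t (fun z => v (inl (inl z))) (tnth a) (tnth b)) a b.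
  split.
    case/connectP=> p; elim: p a => [|y p IH] x /=; first by move=> _ ->; apply: rt_refl.
    move=> /andP[/He[Hxy _] Hp] E; apply: rt_trans (IH y Hp E); exact: rt_step.
  (* Cutting the step out of [b] loses nothing: a path to [b] that starts at [b] is replaced by the
     empty path. *)
  have Hgen x y : clos_refl_trans_1n _ (fun a b : k.-tuple (node t) =>
      R t (fun z => v (inl (inl z))) (tnth a) (tnth b)) x y -> y = b -> connect e x y.
    elim=> {x y} [x _|x y z Hxy _ IH Ez]; first exact: connect0.
    case: (eqVneq x z) => [->|ne]; first exact: connect0.
    apply: connect_trans (IH Ez); apply/connect1/He; split=> // /tnth_eq Ex.
    by rewrite Ex Ez eqxx in ne.
  by move/clos_rt_rt1n_iff => H; apply: Hgen H _.
pose good c m (r : bool) := wp (iterate body m) (c, alpha)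
  (fun b (c' : config k X t) => c'.2 = alpha /\ b = r).
suff Hgood : good b true (connect e a b).
  by apply: wp_mono Hgood _ => r c [-> ->].
apply: (@depth_first_search _ e lt a b _ _ _ _ _ good); rewrite /good => {good}.
- by move=> x y z /He[Hxy _] /He[Hxz _]; apply: Rfun Hxy Hxz.
- move=> x; apply/negP => Hb; have [_ []] := (He b x).2 Hb; exact: (tnth_eq b _).2 erefl.
- by move=> x; apply: lex_irr.
- by move=> y x z; apply: lex_trans.
- exact: tuple_before_total.
- apply/wp_iterate/wp_bind/(wp_mono (H1 _ _ _ _ Hr)) => -[|] [u' alpha'] /= [-> H].
    exact: wp_ret.
  by case: H => _ /(_ a)[]; split=> [//|i]; rewrite tnth_mktuple.
- move=> c r ne Hex Hc.
  apply/wp_iterate/wp_bind/(wp_mono (H1 _ _ _ _ Hr)) => -[|] [u' alpha'] /= [-> H].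
    by case: H => _ /tnth_eq Ec; rewrite Ec eqxx in ne.
  case: H => -> _; apply/wp_bind/(wp_mono (H3 _ _ _ _ Hr)) => -[|] [u'' alpha''] /= [-> H].
    by apply/wp_ret/Hc/Efirst.
  by case: H => _ H; case: Hex => w /Efirst /H.
- move=> c r ne Hex Hc.
  apply/wp_iterate/wp_bind/(wp_mono (H1 _ _ _ _ Hr)) => -[|] [u' alpha'] /= [-> H].
    by case: H => _ /tnth_eq Ec; rewrite Ec eqxx in ne.
  case: H => -> _; apply/wp_bind/(wp_mono (H3 _ _ _ _ Hr)) => -[|] [u'' alpha''] /= [-> H].
    by case: Hex; exists u''; apply/Efirst.
  by case: H => -> _; apply/wp_ret.
- apply/wp_iterate/wp_bind/(wp_mono (H2 _ _ _ _ Hr)) => -[|] [u' alpha'] /= [-> H].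
    exact: wp_ret.
  by case: H => _ /(_ b)[]; split=> [//|i]; rewrite tnth_mktuple.
- move=> c r ne Hex Hc.
  apply/wp_iterate/wp_bind/(wp_mono (H2 _ _ _ _ Hr)) => -[|] [u' alpha'] /= [-> H].
    by case: H => _ /tnth_eq Ec; rewrite Ec eqxx in ne.
  case: H => -> _; apply/wp_bind/(wp_mono (H4 _ _ _ _ Hr)) => -[|] [u'' alpha''] /= [-> H].
    by apply/wp_ret/Hc/Enext.
  by case: H => _ H; case: Hex => w /Enext /H.
- move=> c r ne Hex Hp Hc.
  apply/wp_iterate/wp_bind/(wp_mono (H2 _ _ _ _ Hr)) => -[|] [u' alpha'] /= [-> H].
    by case: H => _ /tnth_eq Ec; rewrite Ec eqxx in ne.
  case: H => -> _; apply/wp_bind/(wp_mono (H4 _ _ _ _ Hr)) => -[|] [u'' alpha''] /= [-> H].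
    by case: Hex; exists u''; apply/Enext.
  case: H => -> _; apply/wp_bind/(wp_mono (H5 _ _ _ _ Hr)) => -[|] [u3 alpha3] /= [-> H].
    by apply/wp_ret/Hc/He.
  by case: H => _ H; case: Hp => w /He /H.
Qed.

End DTC.

(** * Evaluation of all formulas, by induction *)

Section Formulas.
Variables (Sigma : finType) (rank : Sigma -> nat) (k : nat) (hk : 0 < k).

Lemma decidable_formula (phi : formula Sigma k) :
  is_FO_DTC rank phi -> pebble_decidable k (fun (t : tree rank) (v : nat -> node t) => sat v phi).
Proof.
elim: phi => [s x|i x y|x y|x y|phi IH|phi IH psi IH'|phi IH psi IH'|x phi IH|x phi IH|phi IH xs ys us vs] /=.
- by move=> _; apply: decidable_label.
- by move=> _; apply: decidable_edge.
- by move=> _; apply: decidable_ancestor.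
- by move=> _; apply: decidable_eq.
- by move/IH; apply: decidable_not.
- by move=> [/IH H /IH' H']; apply: decidable_and.
- by move=> [/IH H /IH' H']; apply: decidable_or.
- move/IH/(decidable_exists_list hk [:: x]); apply: decidable_ext => t v.
  split=> [[v' Hv' H]|[w H]].
    exists (v' x); rewrite (_ : update v x (v' x) = v') //.
    apply: functional_extensionality => z; rewrite /update; case: eqP => [->//|/eqP ne].
    by rewrite -Hv' // inE.
  by exists (update v x w) => // z; rewrite inE /update => /negbTE ->.
- move/IH/(decidable_not hk)/(decidable_exists_list hk [:: x])/(decidable_not hk).
  apply: decidable_ext => t v; split=> [H w|H [v' Hv' []]].
    apply: NNPP => Hn; apply: H; exists (update v x w) => // z.
    by rewrite inE /update => /negbTE ->.
  rewrite (_ : v' = update v x (v' x)) //.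
  apply: functional_extensionality => z; rewrite /update; case: eqP => [->//|/eqP ne].
  by rewrite -Hv' // inE.
- move=> [_ /IH H Hfun].
  pose R : tuple_relation rank k nat := fun t v c w =>
    sat (update_tuple (update_tuple v xs (mktuple c)) ys (mktuple w)) phi.
  have HR : relation_decidable R.
    apply: relation_decidable_extend.
    (* The two nested [nth] imitate the two nested [update_tuple]: a name in [ys] takes precedence
       over one in [xs], and any other name keeps its own value as the default. *)
    pose s z : nat + 'I_k + 'I_k :=
      nth (nth (inl (inl z)) [tuple inl (inr i) | i < k] (index z xs)) [tuple inr i | i < k] (index z ys).
    apply: decidable_ext (decidable_reindex s H) => t v; rewrite /R.
    rewrite (_ : (fun z => v (s z)) = update_tuple (update_tuple (fun z => v (inl (inl z))) xs
      [tuple v (inl (inr i)) | i < k]) ys [tuple v (inr i) | i < k]) //.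
    have Hmap (d : nat + 'I_k + 'I_k) (f : 'I_k -> nat + 'I_k + 'I_k) j :
        v (nth d [tuple f i | i < k] j) = nth (v d) [tuple v (f i) | i < k] j.
      case: (ltnP j k) => Hj; last by rewrite !nth_default ?size_tuple.
      by rewrite !(nth_mktuple _ _ (Ordinal Hj)).
    by apply: functional_extensionality => z; rewrite /update_tuple /s !Hmap.
  have := decidable_dtc hk 0 HR.
  move/(_ _)/(decidable_reindex (fun z : nat + 'I_k + 'I_k =>
    match z with inl (inl z) => z | inl (inr i) => tnth us i | inr i => tnth vs i end)).
  have mktnth t (c : k.-tuple (node t)) : mktuple (tnth c) = c.
    by apply/esym/tnth_eq.
  have HRE t v a b : R t v (tnth a) (tnth b) =
      sat (update_tuple (update_tuple v xs a) ys b) phi by rewrite /R !mktnth.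
  move=> Hd; apply: decidable_ext (Hd _) => [t v|t v a b b']; last first.
    by rewrite !HRE; apply: Hfun.
  rewrite (_ : mktuple _ = map_tuple v us); last by apply/esym/tnth_eq => i; rewrite tnth_map.
  rewrite (_ : mktuple _ = map_tuple v vs); last by apply/esym/tnth_eq => i; rewrite tnth_map.
  rewrite (_ : (fun a b => _) = fun a b => sat (update_tuple (update_tuple v xs a) ys b) phi) //.
  by do 2 apply: functional_extensionality => ?; rewrite HRE.
Qed.

End Formulas.

(** * From formulas to automata *)

(** There is only one run from [x], so [y] lies on the run that stops at [z]. *)
Lemma functional_rt_confluent (T : Type) (R : T -> T -> Prop) x y z :
  (forall a b c, R a b -> R a c -> b = c) ->
  clos_refl_trans T R x y -> clos_refl_trans T R x z -> (forall z', ~ R z z') ->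
  clos_refl_trans T R y z.
Proof.
move=> HR /clos_rt_rt1n_iff Hxy; elim: Hxy z => {x y} [//|x y y' Hxy _ IH] z Hxz Hz.
apply: IH (Hz) => //; move/clos_rt_rt1n_iff: Hxz => Hxz; case: Hxz Hxy Hz => [H /(_ _ H)//|w z' Hxw Hwz Hxy Hz].
by rewrite (HR _ _ _ Hxy Hxw); apply/clos_rt_rt1n_iff.
Qed.

Lemma functional_rt_terminal (T : Type) (R : T -> T -> Prop) x y z :
  (forall a b c, R a b -> R a c -> b = c) ->
  clos_refl_trans T R x y -> (forall y', ~ R y y') ->
  clos_refl_trans T R x z -> (forall z', ~ R z z') -> y = z.
Proof.
move=> HR Hxy Hy Hxz Hz; have := functional_rt_confluent HR Hxy Hxz Hz.
by move/clos_rt_rt1n_iff => H; case: H Hy => [//|w z' H _ /(_ _ H)].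
Qed.

Section Determinism.
Variables (Sigma : finType) (rank : Sigma -> nat) (k : nat).
Variables (A : automaton Sigma k) (t : tree rank).

Lemma exec_fun chi u alpha u1 alpha1 u2 alpha2 :
  @exec _ _ _ A t chi u alpha u1 alpha1 -> exec chi u alpha u2 alpha2 ->
  u1 = u2 /\ alpha1 = alpha2.
Proof.
case: chi => [i|i j|i x|x|tau|tau] /=.
- move=> [-> [w [j [Hw ->]]]] [-> [w' [j' [Hw' ->]]]].
  by have [-> _] := is_child_inj Hw Hw'.
- by move=> [-> [w [Hw ->]]] [-> [w' [Hw' ->]]]; rewrite (is_child_fun Hw Hw').
- by move=> [-> [_ ->]] [-> [_ ->]].
- by move=> [-> [w ->]] [-> [w' []]].
- by move=> [[-> ->] _] [[-> ->] _].
- by move=> [[-> ->] _] [[-> ->] _].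
Qed.

(** Distinct instructions of one state are a test and its negation, which cannot both succeed. *)
Lemma deterministic_exec (p : state A) q1 q2 chi1 chi2 u alpha u1 alpha1 u2 alpha2 :
  deterministic A -> (p, chi1, q1) \in instructions A ->
  (p, chi2, q2) \in instructions A ->
  @exec _ _ _ A t chi1 u alpha u1 alpha1 -> exec chi2 u alpha u2 alpha2 ->
  chi1 = chi2 /\ q1 = q2.
Proof.
move=> Hdet H1 H2 He1 He2.
case: (eqVneq (p, chi1, q1) (p, chi2, q2)) => [[-> ->]//|ne].
case: (Hdet _ _ _ _ _ H1 H2 ne) => -[tau [E1 E2]]; subst chi1 chi2.
  by case: He1 => _ []; case: He2.
by case: He2 => _ []; case: He1.
Qed.

Lemma step_fun (c c1 c2 : configuration A t) :
  deterministic A -> step c c1 -> step c c2 -> c1 = c2.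
Proof.
move: c c1 c2 => [[p u] alpha] [[q1 u1] alpha1] [[q2 u2] alpha2] Hdet.
move=> [chi1 [H1 He1]] [chi2 [H2 He2]].
have [E ->] := deterministic_exec Hdet H1 H2 He1 He2; subst chi2.
by have [-> ->] := exec_fun He1 He2.
Qed.
End Determinism.

Section AutomatonOfFlowchart.
Variables (Sigma : finType) (rank : Sigma -> nat) (k : nat) (X : finType).
Variable F : flowchart Sigma k X bool.

Definition point_instructions (s : point F) :=
  match code s with
  | Act chi n => [:: (inl s : point F + bool, chi, n)]
  | Branch tau n1 n2 => [:: (inl s, Pos tau, n1); (inl s, Neg tau, n2)]
  end.

(** The exits become states without instructions, hence halting ones. *)
Definition automaton_of : automaton Sigma k :=
  @Automaton Sigma k (point F + bool)%type X (inl (entry F)) [set inr true]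
    (flatten [seq point_instructions s | s : point F]).

Lemma mem_automaton_of p chi q :
  (p, chi, q) \in instructions automaton_of <->
  exists2 s, p = inl s & (p, chi, q) \in point_instructions s.
Proof.
split.
  case/flattenP => l /mapP[s _ ->] H; exists s => //; move: H.
  rewrite /point_instructions; case: (code s) => [chi' n|tau n1 n2]; rewrite !inE.
    by move=> /eqP[-> _ _].
  by case/orP => /eqP[-> _ _].
move=> [s -> H]; apply/flattenP; exists (point_instructions s) => //.
by apply: map_f; rewrite mem_enum.
Qed.

Lemma automaton_of_deterministic : deterministic automaton_of.
Proof.
move=> p q1 q2 chi1 chi2 /mem_automaton_of[s -> H1] /mem_automaton_of[s' [<-] H2].
move: H1 H2; rewrite /point_instructions; case: (code s) => [chi n|tau n1 n2]; rewrite !inE.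
  by move=> /eqP[-> ->] /eqP[-> ->]; rewrite eqxx.
move=> /orP[] /eqP[-> ->] /orP[] /eqP[-> ->]; rewrite ?eqxx // => _.
  by right; exists tau.
by left; exists tau.
Qed.

Lemma step_of_fstep (t : tree rank) c c' :
  @fstep Sigma rank k X t bool F c c' ->
  @step Sigma rank k automaton_of t (c.1, c.2.1, c.2.2) (c'.1, c'.2.1, c'.2.2).
Proof.
case: c c' => [[s|//] [u alpha]] [x' [u' alpha']]; rewrite /fstep /=.
case E: (code s) => [chi n|tau n1 n2] /=.
  move=> [-> H]; exists chi; split=> //; apply/mem_automaton_of; exists s => //.
  by rewrite /point_instructions E inE.
move=> [[-> ->] [[H ->]|[H ->]]]; [exists (Pos tau)|exists (Neg tau)]; split=> //;
  by apply/mem_automaton_of; exists s => //; rewrite /point_instructions E !inE eqxx ?orbT.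
Qed.

(** The run of [F] ends in a halting configuration, and determinism excludes a second one; so the
    exit [false] rules out acceptance. *)
Lemma accepts_automaton_of (t : tree rank) (P : Prop) :
  wp F (nseq_tuple k (tree_root t), [::]) (fun b c =>
    c = (nseq_tuple k (tree_root t), [::]) /\ (b <-> P)) ->
  accepts automaton_of t <-> P.
Proof.
move=> [b [c [Hrun [Ec HP]]]]; subst c.
have Hhalt b' u alpha : @halting _ _ _ automaton_of t (inr b', u, alpha).
  by move=> [[q u'] alpha'] [chi [/mem_automaton_of[]]].
have {}Hrun : clos_refl_trans _ (@step _ _ _ automaton_of t)
    (@root_config _ _ _ automaton_of t (inl (entry F))) (@root_config _ _ _ automaton_of t (inr b)).
  have: forall c c', clos_refl_trans _ (@fstep _ _ _ _ t _ F) c c' ->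
    clos_refl_trans _ (@step _ _ _ automaton_of t) (c.1, c.2.1, c.2.2) (c'.1, c'.2.1, c'.2.2).
    move=> c c'; elim=> [{}c {}c' H|{}c|x y z _ H _ H']; last exact: rt_trans H H'.
      exact/rt_step/step_of_fstep.
    exact: rt_refl.
  by move/(_ _ _ Hrun).
split=> [[p [Hp Hrun' Hhalt']]|/HP Hb].
  have := functional_rt_terminal (fun a b c => @step_fun _ _ _ _ _ a b c automaton_of_deterministic)
    Hrun (Hhalt b (nseq_tuple k (tree_root t)) [::]) Hrun' Hhalt'.
  by case=> E; rewrite -E inE in Hp; apply/HP; case/eqP: Hp => ->.
exists (inr b); split=> //; first by rewrite inE Hb.
exact: (Hhalt b (nseq_tuple k (tree_root t)) [::]).
Qed.
End AutomatonOfFlowchart.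

(** * Truth depends only on the free variables *)

Section Coincidence.
Variables (Sigma : finType) (rank : Sigma -> nat) (k : nat) (t : tree rank).

Lemma eq_clos_refl_trans (T : Type) (R R' : T -> T -> Prop) x y :
  (forall a b, R a b <-> R' a b) ->
  clos_refl_trans T R x y <-> clos_refl_trans T R' x y.
Proof.
move=> H; split; elim=> [a b /H Hab|a|a b c _ H1 _ H2]; try exact: rt_refl;
  try exact: rt_trans H1 H2; exact: rt_step.
Qed.

Lemma index_tuple_lt (zs : k.-tuple nat) z : (index z zs < k) = (z \in zs).
Proof. by rewrite -index_mem size_tuple. Qed.

Lemma sat_free_vars (phi : formula Sigma k) (v v' : valuation t) :
  {in free_vars phi, v =1 v'} -> sat v phi <-> sat v' phi.
Proof.
elim: phi v v' => [s x|i x y|x y|x y|phi IH|phi IH psi IH'|phi IH psi IH'|x phi IH|x phi IH|phi IH xs ys us vs] v v' /= H.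
- by rewrite H ?mem_head.
- by rewrite !H ?inE ?eqxx ?orbT.
- by rewrite !H ?inE ?eqxx ?orbT.
- by rewrite !H ?inE ?eqxx ?orbT.
- by rewrite (IH v v').
- rewrite (IH v v') ?(IH' v v') // => z Hz; apply: H; by rewrite mem_cat Hz ?orbT.
- rewrite (IH v v') ?(IH' v v') // => z Hz; apply: H; by rewrite mem_cat Hz ?orbT.
- have E u : sat (update v x u) phi <-> sat (update v' x u) phi.
    apply: IH => z Hz; rewrite /update; case: eqP => // /eqP ne; apply: H.
    by rewrite mem_filter ne.
  by split=> -[u /E Hu]; exists u.
- have E u : sat (update v x u) phi <-> sat (update v' x u) phi.
    apply: IH => z Hz; rewrite /update; case: eqP => // /eqP ne; apply: H.
    by rewrite mem_filter ne.
  by split=> H' u; apply/E.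
- have Hmap (ws : k.-tuple nat) : {subset ws <= us ++ vs} -> map_tuple v ws = map_tuple v' ws.
    move=> Hws; apply: val_inj => /=; apply/eq_in_map => z /Hws Hz.
    by apply: H; rewrite mem_cat Hz orbT.
  rewrite !Hmap; try by move=> z Hz; rewrite mem_cat Hz ?orbT.
  apply: eq_clos_refl_trans => a b; apply: IH => z Hz; rewrite /update_tuple.
  (* For a name in [ys] the two sides differ only in the default of [nth], which is not reached;
     likewise for [xs] below. *)
  case: (boolP (z \in ys)) => Hys.
    by apply: set_nth_default; rewrite size_tuple index_tuple_lt.
  rewrite !(@nth_default _ _ b) ?size_tuple 1?leqNgt ?index_tuple_lt //.
  case: (boolP (z \in xs)) => Hxs.
    by apply: set_nth_default; rewrite size_tuple index_tuple_lt.
  rewrite !(@nth_default _ _ a) ?size_tuple 1?leqNgt ?index_tuple_lt //.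
  by apply: H; rewrite mem_cat mem_filter mem_cat negb_or Hxs Hys Hz.
Qed.

Lemma models_closed (phi : formula Sigma k) (v : valuation t) :
  closed_formula phi -> models t phi <-> sat v phi.
Proof.
move=> /eqP E; split=> [H|H v']; first exact: H.
by apply: (sat_free_vars _).1 H => z; rewrite E.
Qed.
End Coincidence.

Theorem automaton_of_formula (Sigma : finType) (rank : Sigma -> nat) (k : nat)
    (hk : 0 < k) (phi : formula Sigma k) :
  is_FO_DTC rank phi -> closed_formula phi ->
  exists A : automaton Sigma k,
    deterministic A /\ forall t : tree rank, accepts A t <-> models t phi.
Proof.
move=> /(decidable_formula hk)[n Hdec] Hclosed.
(* The extra pebble [ord0], dropped at the root, marks all variables at once: the formula is closed,
   so the constant valuation will do. *)
pose h : 'I_k := Ordinal hk; pose X : finType := 'I_n.+1.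
have [||F HF] := Hdec X (fun _ => ord0) (behead (enum X)).
- by have := enum_uniq X; case: (enum X) => //= x s /andP[].
- by rewrite size_behead size_enum_ord.
have Hfr : ord0 \notin behead (enum X).
  by have := enum_uniq X; rewrite enum_ordSl /= => /andP[].
(* Acceptance requires all heads at the root and an empty stack, whence the cleaning up after
   [F]. *)
pose G := bind (act (Drop Sigma h (ord0 : X))) (fun _ => bind F (fun b =>
  bind (in_sequence h (fun i => goto_root h i) (enum 'I_k)) (fun _ =>
  bind (act (Retrieve _ _ (ord0 : X))) (fun _ => ret h b)))).
exists (automaton_of G); split; first exact: automaton_of_deterministic.
move=> t; set r := tree_root t.
apply: iff_trans (iff_sym (models_closed (fun _ => r) Hclosed)).
apply: accepts_automaton_of; apply/wp_bind/(@wp_act _ _ _ _ _ _ _ (nseq_tuple k r, [:: (ord0, r)])).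
  by split=> //; split=> //=; rewrite tnth_nseq.
apply/wp_bind/wp_mono; first apply: (HF t (fun _ => r)).
  split=> //= x Hx.
  by rewrite inE; apply: contraNneq Hfr => <-.
move=> b [u alpha] /= [-> Hb].
apply: wp_bind. have: forall i, i \notin enum 'I_k -> tnth u i = r by move=> i; rewrite mem_enum.
elim: (enum 'I_k) u => [|i s IH] u Hu /=.
  apply: wp_ret; apply/wp_bind/(@wp_act _ _ _ _ _ _ _ (u, [::])).
    by split=> //; exists r.
  apply: wp_ret; split=> //; congr (_, _).
  by apply: eq_from_tnth => i; rewrite tnth_nseq Hu.
apply/wp_bind/wp_goto_root/IH => j Hj; rewrite tnth_move_head.
by case: eqP => // /eqP ne; apply: Hu; rewrite in_cons negb_or ne.
Qed.

(** * Definable relations and runs *)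

Section Definability.
Variables (Sigma : finType) (rank : Sigma -> nat) (k : nat).

Local Notation predicate := (predicate rank).

(** All maps [name] are allowed, injective or not, so that substituting variables is composition;
    [V] is finite so that fresh names exist. *)
Definition definable (V : finType) (P : predicate V) : Prop :=
  forall name : V -> nat, exists phi : formula Sigma k,
    is_FO_DTC rank phi /\
    forall (t : tree rank) (v : valuation t), sat v phi <-> P t (fun z => v (name z)).

Lemma definable_ext (V : finType) (P P' : predicate V) :
  (forall t v, P t v <-> P' t v) -> definable P -> definable P'.
Proof.
move=> HP H name; have [phi [H1 H2]] := H name; exists phi; split=> // t v.
by rewrite H2 HP.
Qed.

Lemma definable_not (V : finType) (P : predicate V) :
  definable P -> definable (fun t v => ~ P t v).
Proof.
move=> H name; have [phi [H1 H2]] := H name; exists (FNot phi); split=> // t v /=.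
by rewrite H2.
Qed.

Lemma definable_and (V : finType) (P P' : predicate V) :
  definable P -> definable P' -> definable (fun t v => P t v /\ P' t v).
Proof.
move=> H H' name; have [phi [H1 H2]] := H name; have [psi [H1' H2']] := H' name.
by exists (FAnd phi psi); split=> // t v /=; rewrite H2 H2'.
Qed.

Lemma definable_or (V : finType) (P P' : predicate V) :
  definable P -> definable P' -> definable (fun t v => P t v \/ P' t v).
Proof.
move=> H H' name; have [phi [H1 H2]] := H name; have [psi [H1' H2']] := H' name.
by exists (FOr phi psi); split=> // t v /=; rewrite H2 H2'.
Qed.

Lemma definable_eq (V : finType) (x y : V) : definable (fun t v => v x = v y).
Proof. by move=> name; exists (FEq _ _ (name x) (name y)). Qed.

Lemma definable_edge (V : finType) i (x y : V) :
  definable (fun t v => is_child i (v x) (v y)).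
Proof. by move=> name; exists (FEdg _ _ i (name x) (name y)). Qed.

Lemma definable_label (V : finType) s (x : V) : definable (fun t v => has_label s (v x)).
Proof. by move=> name; exists (FLab _ s (name x)). Qed.

Lemma definable_false (V : finType) (x : V) : definable (fun t (v : V -> node t) => False).
Proof.
apply: definable_ext (definable_and (definable_eq x x) (definable_not (definable_eq x x))) => t v.
by tauto.
Qed.

Lemma definable_forall_node (V : finType) (P : predicate (option V)) :
  definable P ->
  definable (fun t (v : V -> node t) => forall u, P t (fun o => oapp v u o)).
Proof.
(* A fresh name, so that the quantifier captures no variable. *)
move=> H name; pose x := (\max_z name z).+1.
have [phi [H1 H2]] := H (fun o => oapp name x o).
exists (FAll x phi); split=> // t v /=.
have E u : (fun o => update v x u (oapp name x o)) = (fun o => oapp (fun z => v (name z)) u o).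
  apply: functional_extensionality => -[z|] /=; rewrite /update ?eqxx //.
  by rewrite ltn_eqF // ltnS leq_bigmax.
by split=> H' u; have := H' u; rewrite H2 E.
Qed.

Lemma definable_root (V : finType) (x : V) : definable (fun t v => v x = tree_root t).
Proof.
have H : definable (fun t (v : option V -> node t) => ancestor (v (Some x)) (v None)).
  by move=> name; exists (FLe _ _ (name (Some x)) (name None)).
by apply: definable_ext (definable_forall_node H) => t v; apply: root_ancestor.
Qed.

Lemma definable_exists_seq (V : finType) (x : V) (J : eqType) (s : seq J) (P : J -> predicate V) :
  (forall j, j \in s -> definable (P j)) ->
  definable (fun t v => exists2 j, j \in s & P j t v).
Proof.
elim: s => [|j s IH] H; first by apply: definable_ext (definable_false x) => t v; split=> // -[].
apply: definable_ext (definable_or (H j _) (IH _)) => [t v||i Hi]; last 2 first.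
- exact: mem_head.
- by apply: H; rewrite in_cons Hi orbT.
split=> [[Hj|[i Hi HP]]|[i]]; first by exists j; rewrite ?mem_head.
  by exists i; rewrite // in_cons Hi orbT.
by rewrite in_cons => /predU1P[->|Hi] HP; [left|right; exists i].
Qed.

Lemma sat_exists_list l (phi : formula Sigma k) (t : tree rank) (v : valuation t) :
  sat v (foldr (@FEx _ _) phi l) <-> exists2 v', agree_off l v' v & sat v' phi.
Proof.
elim: l v => [|x l IH] v /=.
  split=> [H|[v' Hv']]; first by exists v.
  by rewrite (_ : v' = v) //; apply: functional_extensionality => z; apply: Hv'.
split=> [[u /IH[v' Hv' H]]|[v' Hv' H]].
  exists v' => // z; rewrite in_cons negb_or => /andP[ne Hz].
  by rewrite Hv' // /update (negbTE ne).
exists (v' x); apply/IH; exists v' => // z Hz; rewrite /update.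
by case: eqP => [->//|/eqP ne]; apply: Hv'; rewrite in_cons negb_or ne.
Qed.

Definition tuple_rel (V : Type) : Type :=
  forall t : tree rank, (V -> node t) -> k.-tuple (node t) -> k.-tuple (node t) -> Prop.

Definition rel_definable (V : finType) (R : tuple_rel V) : Prop :=
  forall (V' : finType) (e : V -> V') (f g : 'I_k -> V'),
    definable (fun t v => R t (fun z => v (e z)) (mktuple (fun i => v (f i)))
                            (mktuple (fun i => v (g i)))).

Lemma definable_exists_tuple (V : finType)
    (P : forall t : tree rank, (V -> node t) -> k.-tuple (node t) -> Prop) :
  definable (fun t (v : V + 'I_k -> node t) =>
    P t (fun z => v (inl z)) (mktuple (fun i => v (inr i)))) ->
  definable (fun t v => exists w, P t v w).
Proof.
move=> H name; pose base := (\max_z name z).+1.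
have Hb z : name z < base by rewrite ltnS leq_bigmax.
have [phi [H1 H2]] := H (extend name (fun i => base + i)).
exists (foldr (@FEx _ _) phi [seq base + i | i <- iota 0 k]); split.
  by elim: (map _ _).
move=> t v; rewrite sat_exists_list; split=> [[v' Hv' /H2 /= HP]|[w HP]].
  exists [tuple v' (base + i) | i < k].
  rewrite (_ : (fun z => v (name z)) = (fun z => v' (name z))) //.
  apply: functional_extensionality => z; rewrite Hv' //; apply/mapP => -[i _ E].
  by have := Hb z; rewrite E; lia.
exists (fun z => if z < base then v z else nth (v z) w (z - base)).
  move=> z Hz; case: ltnP => // Hle; rewrite nth_default // size_tuple leqNgt.
  apply: contra Hz => Hlt; apply/mapP; exists (z - base); last by lia.
  by rewrite mem_iota.
apply/H2; rewrite /=.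
rewrite (_ : (fun z => _) = fun z => v (name z)); last first.
  by apply: functional_extensionality => z; rewrite Hb.
rewrite (_ : mktuple _ = w) //; apply/esym/tnth_eq => i.
by rewrite ltnNge leq_addr /= addKn (tnth_nth (v (base + i))).
Qed.

Lemma update_tuple_in (t : tree rank) (v : valuation t) (xs : k.-tuple nat) us i :
  uniq xs -> update_tuple v xs us (tnth xs i) = tnth us i.
Proof.
move=> Hu; rewrite /update_tuple (tnth_nth 0) index_uniq ?size_tuple //.
by rewrite -tnth_nth.
Qed.

Lemma update_tuple_out (t : tree rank) (v : valuation t) (xs : k.-tuple nat) us z :
  z \notin xs -> update_tuple v xs us z = v z.
Proof.
by move=> Hz; rewrite /update_tuple nth_default // size_tuple leqNgt index_tuple_lt.
Qed.

Lemma definable_dtc (V : finType) (R : tuple_rel V) :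
  rel_definable R ->
  (forall t v a b b', R t v a b -> R t v a b' -> b = b') ->
  rel_definable (fun t v => clos_refl_trans (k.-tuple (node t)) (R t v)).
Proof.
move=> HR Rfun V' e f g name; pose base := (\max_z name z).+1.
have Hb z : name z < base by rewrite ltnS leq_bigmax.
have [phi [H1 H2]] := HR _ (fun z => inl (inl (e z))) (fun i => inl (inr i)) inr
  (extend (extend name (fun i : 'I_k => base + i)) (fun i : 'I_k => base + k + i)).
rewrite /= in H2.
(* Two disjoint blocks of fresh names: [is_FO_DTC] demands distinct variables, and the parameters
   must not be captured. *)
pose xs := [tuple base + i | i < k]; pose ys := [tuple base + k + i | i < k].
have Ux : uniq xs.
  by rewrite map_inj_uniq ?enum_uniq // => i j /addnI /val_inj.
have Uy : uniq ys.
  by rewrite map_inj_uniq ?enum_uniq // => i j /addnI /val_inj.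
have Hx z : z \in xs -> base <= z < base + k.
  by move/mapP=> [i _ ->]; rewrite leq_addr /= ltn_add2l.
have Hy z : z \in ys -> base + k <= z.
  by move/mapP=> [i _ ->]; rewrite leq_addr.
have Hsat (t : tree rank) (v : valuation t) a b :
    sat (update_tuple (update_tuple v xs a) ys b) phi <-> R t (fun z => v (name (e z))) a b.
  rewrite H2 (_ : (fun z => _) = fun z => v (name (e z))); last first.
    apply: functional_extensionality => z.
    rewrite !update_tuple_out //; apply/negP; first [move/Hx|move/Hy]; have := Hb (e z); lia.
  rewrite (_ : mktuple _ = a); last first.
    apply/esym/tnth_eq => i; have <- : tnth xs i = base + i by rewrite tnth_mktuple.
    rewrite update_tuple_out ?update_tuple_in //; apply/negP => /Hy H'.
    by have /andP[_] := Hx _ (mem_tnth i xs); rewrite ltnNge H'.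
  rewrite (_ : mktuple _ = b) //; apply/esym/tnth_eq => i.
  have <- : tnth ys i = base + k + i by rewrite tnth_mktuple.
  by rewrite update_tuple_in.
exists (FTC phi xs ys [tuple name (f i) | i < k] [tuple name (g i) | i < k]); split.
  split=> //; last by move=> t v a b b' /Hsat H /Hsat H'; apply: Rfun H H'.
  rewrite cat_uniq Ux Uy andbT /=; apply/hasPn => z /Hy Hz; apply/negP => /Hx; lia.
move=> t v /=.
rewrite (_ : map_tuple v _ = [tuple v (name (f i)) | i < k]); last first.
  by apply/tnth_eq => i; rewrite tnth_map tnth_mktuple.
rewrite (_ : map_tuple v _ = [tuple v (name (g i)) | i < k]); last first.
  by apply/tnth_eq => i; rewrite tnth_map tnth_mktuple.
by apply: eq_clos_refl_trans => a b; apply: Hsat.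
Qed.

End Definability.

(* Kleene's construction: [eliminate l p q] describes the nonempty paths from
   [p] to [q] whose intermediate states belong to [l]. *)
Section Kleene.
Variables (S : eqType) (T : Type) (N : S -> S -> T -> T -> Prop).

Fixpoint eliminate (l : seq S) (p q : S) (x y : T) : Prop :=
  if l is r :: l' then
    eliminate l' p q x y \/
    exists w w', [/\ eliminate l' p r x w,
      clos_refl_trans T (eliminate l' r r) w w' & eliminate l' r q w' y]
  else N p q x y.

(** The paths described by [eliminate], without reference to the order of [l] and with the first
    step exposed, which is where functionality of [N] acts. *)
Inductive via (l : seq S) : S -> S -> T -> T -> Prop :=
  | via_one p q x y : N p q x y -> via l p q x y
  | via_cons p r q x w y : N p r x w -> r \in l -> via l r q w y -> via l p q x y.

Lemma via_sub l l' p q x y : {subset l <= l'} -> via l p q x y -> via l' p q x y.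
Proof.
move=> Hl; elim=> {p q x y} [p q x y H|p r q x w y H Hr _ IH]; first exact: via_one.
exact: via_cons H (Hl _ Hr) IH.
Qed.

Lemma via_trans l p r q x w y :
  r \in l -> via l p r x w -> via l r q w y -> via l p q x y.
Proof.
move=> Hr H; elim: H Hr => {p r x w} [p r x w H Hr|p s r x z w H Hs _ IH Hr].
  exact: via_cons.
by move/(IH Hr); apply: via_cons.
Qed.

(** A path is cut at its visits to [r]: before the first, between consecutive ones, after the
    last. *)
Lemma eliminate_via l p q x y : eliminate l p q x y <-> via l p q x y.
Proof.
elim: l p q x y => [|r l IH] p q x y /=.
  by split=> [|H]; [exact: via_one|case: H].
have Hsub : {subset l <= r :: l} by move=> s Hs; rewrite in_cons Hs orbT.
split.
  case=> [/IH|[w [w' [/IH H1 H2 /IH H3]]]]; first exact: via_sub.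
  apply: (via_trans (mem_head _ _) (via_sub Hsub H1)) => {H1}.
  move/clos_rt_rt1n_iff: H2 H3; elim=> {w w'} [w|w z w' /IH H _ IH'] H3.
    exact: via_sub H3.
  exact: via_trans (mem_head _ _) (via_sub Hsub H) (IH' H3).
elim=> {p q x y} [p q x y H|p s q x w y H Hs _ IH'].
  by left; apply/IH/via_one.
move: Hs; rewrite in_cons => /predU1P[E|Hs].
  subst s; right; exists w; case: IH' => [H'|[w1 [w2 [H1 H2 H3]]]].
    by exists w; split=> //; [apply/IH/via_one|exact: rt_refl].
  exists w2; split=> //; first exact/IH/via_one.
  exact: rt_trans (rt_step _ _ _ _ H1) H2.
case: IH' => [/IH H'|[w1 [w2 [/IH H1 H2 H3]]]].
  by left; apply/IH; apply: via_cons H Hs H'.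
by right; exists w1, w2; split=> //; apply/IH; apply: via_cons H Hs H1.
Qed.

Hypothesis N_fun : forall p q q' x y y', N p q x y -> N p q' x y' -> q = q' /\ y = y'.

(** As [r] is not an allowed intermediate state, a path to [r] stops at the first arrival, and
    before that a functional [N] leaves no choice. *)
Lemma via_fun l p r x y y' :
  r \notin l -> via l p r x y -> via l p r x y' -> y = y'.
Proof.
move=> Hr H; elim: H y' Hr => {p r x y} [p r x y H|p s r x w y H Hs _ IH] y' Hr H'.
  case: H' Hr H => {p r x y'} [p r x y' H' _ H|p s r x w y' H' Hs _ Hr H].
    by have [] := N_fun H H'.
  by have [E _] := N_fun H H'; rewrite E Hs in Hr.
case: H' Hr H IH => {p r x y'} [p r x y' H' Hr H _|p s' r x w' y' H' Hs' Hv Hr H IH].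
  by have [E _] := N_fun H' H; rewrite E Hs in Hr.
by have [E1 E2] := N_fun H H'; subst; apply: IH.
Qed.

Lemma eliminate_fun l r x y y' :
  r \notin l -> eliminate l r r x y -> eliminate l r r x y' -> y = y'.
Proof. by move=> Hr /eliminate_via H /eliminate_via; apply: via_fun H. Qed.

Definition reach (c c' : S * T) : Prop :=
  clos_refl_trans (S * T) (fun c c' => N c.1 c'.1 c.2 c'.2) c c'.

Lemma reach_eliminate l p q x y : (forall s, s \in l) ->
  reach (p, x) (q, y) <-> (p = q /\ x = y) \/ eliminate l p q x y.
Proof.
move=> Hl; rewrite eliminate_via; split.
  move/clos_rt_rt1n_iff; move E : (p, x) => c; move E' : (q, y) => c' H.
  elim: H p x q y E E' => {c c'} [c|c [s z] c' H _ IH] p x q y E E'.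
    by left; move: E'; rewrite -E => -[-> ->].
  subst c; right; case: (IH s z q y erefl E') => [[Es Ez]|Hv]; rewrite /= in H.
    by apply: via_one; rewrite -Es -Ez.
  exact: via_cons H (Hl s) Hv.
case=> [[-> ->]|]; first exact: rt_refl.
elim=> {p q x y} [p q x y H|p r q x w y H _ _ IH]; first exact: rt_step.
by apply: rt_trans IH; apply: rt_step.
Qed.
End Kleene.

(** * Computations above a fixed stack *)

Section MacroSteps.
Variables (Sigma : finType) (rank : Sigma -> nat) (k : nat) (A : automaton Sigma k).

(* One instruction that leaves the stack unchanged, or an excursion from a
   [drop] to the matching [retrieve]; at most [n] pebbles are dropped. *)
Fixpoint macro (t : tree rank) (n : nat) (alpha : stack A t) (p q : state A)
    (u u' : k.-tuple (node t)) : Prop :=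
  (exists2 i, i \in instructions A &
    [/\ i.1.1 = p, i.2 = q & exec i.1.2 u alpha u' alpha]) \/
  if n is n'.+1 then
    exists i x p' q',
      [/\ (p, Drop _ i x, p') \in instructions A, x \notin unzip1 alpha,
          (q', Retrieve _ _ x, q) \in instructions A &
          reach (macro n' ((x, tnth u i) :: alpha)) (p', u) (q', u')]
  else False.

Section Correctness.
Variable t : tree rank.
Implicit Types (alpha : stack A t) (u : k.-tuple (node t)).
Hypothesis Hdet : deterministic A.

(** By induction on [n] the steps inside an excursion are functional. Its last configuration enables
    a retrieve and hence no macro step, so it is the unique terminal point of the inner
    computation. *)
Lemma macro_fun n alpha p q q' u u1 u2 :
  macro n alpha p q u u1 -> macro n alpha p q' u u2 -> q = q' /\ u1 = u2.
Proof.
(* An instruction that keeps [alpha] is therefore neither a drop nor a retrieve. *)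
have Hloop (x : pebble A) (w : node t) a : (x, w) :: a <> a.
  by move/(f_equal size) => /=; lia.
elim: n alpha p q q' u u1 u2 => [|n IH] alpha p q q' u u1 u2 /=.
  case=> // -[[[p1 chi1] q1] H1 /= [E1 E1' He1]] [] // [[[p2 chi2] q2] H2 /= [E2 E2' He2]].
  subst p q q' p2; have [E ->] := deterministic_exec Hdet H1 H2 He1 He2; subst chi2.
  by have [-> _] := exec_fun He1 He2.
have Hmix chi q1 u' i x p' : (p, chi, q1) \in instructions A -> exec chi u alpha u' alpha ->
    (p, Drop _ i x, p') \in instructions A -> x \notin unzip1 alpha -> False.
  move=> H1 He1 H2 Hx.
  have He2 : exec (Drop Sigma i x) u alpha u ((x, tnth u i) :: alpha) by [].
  have [E _] := deterministic_exec Hdet H1 H2 He1 He2; subst chi.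
  by case: He1 => _ [_ /esym /Hloop].
case=> [[[[p1 chi1] q1] H1 /= [E1 E1' He1]]|[i [x [p1 [q1 [H1 Hx H1' Hr1]]]]]];
  case=> [[[[p2 chi2] q2] H2 /= [E2 E2' He2]]|[j [y [p2 [q2 [H2 Hy H2' Hr2]]]]]].
- subst; have [E ->] := deterministic_exec Hdet H1 H2 He1 He2; subst chi2.
  by have [-> _] := exec_fun He1 He2.
- by subst; case: (Hmix _ _ _ _ _ _ H1 He1 H2 Hy).
- by subst; case: (Hmix _ _ _ _ _ _ H2 He2 H1 Hx).
have He1 : exec (Drop Sigma i x) u alpha u ((x, tnth u i) :: alpha) by [].
have He2 : exec (Drop Sigma j y) u alpha u ((y, tnth u j) :: alpha) by [].
have [[E1 E2] E3] := deterministic_exec Hdet H1 H2 He1 He2; subst j y p2.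
(* By determinism, any instruction enabled where [x] is on top is this retrieve, and that shortens
   the stack; both kinds of macro steps would need a different effect. *)
have Hret q3 q4 u3 : (q3, Retrieve _ _ x, q4) \in instructions A ->
    forall c, ~ macro n ((x, tnth u i) :: alpha) q3 c.1 u3 c.2.
  move=> H3 [q5 u5] /= H5.
  have He3 : exec (Retrieve Sigma k x) u3 ((x, tnth u i) :: alpha) u3 alpha.
    by split=> //; exists (tnth u i).
  have Hloc chi q6 u6 alpha6 : (q3, chi, q6) \in instructions A ->
      exec chi u3 ((x, tnth u i) :: alpha) u6 alpha6 -> alpha6 = alpha.
    move=> H6 He6; have [E _] := deterministic_exec Hdet H6 H3 He6 He3; subst chi.
    by have [_ ->] := exec_fun He6 He3.
  have Hl : (exists2 i0, i0 \in instructions A &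
      [/\ i0.1.1 = q3, i0.2 = q5 & exec i0.1.2 u3 ((x, tnth u i) :: alpha) u5 ((x, tnth u i) :: alpha)]) -> False.
    by move=> [[[p6 chi6] q6] H6 /= [E6 E6' He6]]; subst; have /Hloop := Hloc _ _ _ _ H6 He6.
  case: n H5 {IH} Hr1 Hr2 => [|n] /= [/Hl //|] //.
  move=> [j [y [p6 [q6 [H6 Hy' _ _]]]]] _ _.
  have He6 : exec (Drop Sigma j y) u3 ((x, tnth u i) :: alpha) u3 ((y, tnth u3 j) :: (x, tnth u i) :: alpha) by [].
  by have := Hloc _ _ _ _ H6 He6; move/(f_equal size) => /=; lia.
have [E1 E2] : q1 = q2 /\ u1 = u2.
  suff [-> ->] : (q1, u1) = (q2, u2) by [].
  apply: functional_rt_terminal Hr1 _ Hr2 _.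
  - by move=> [? ?] [? ?] [? ?] /= H H'; have [-> ->] := IH _ _ _ _ _ _ _ H H'.
  - by move=> c; apply: Hret H1' c.
  - by move=> c; apply: Hret H2' c.
subst q2 u2; split=> //.
have He3 : exec (Retrieve Sigma k x) u1 ((x, tnth u i) :: alpha) u1 alpha.
  by split=> //; exists (tnth u i).
by have [_ ->] := deterministic_exec Hdet H1' H2' He3 He3.
Qed.

Lemma macro_sound n alpha p q u u' :
  macro n alpha p q u u' ->
  clos_refl_trans _ (@step _ _ _ A t) (p, u, alpha) (q, u', alpha).
Proof.
elim: n alpha p q u u' => [|n IH] alpha p q u u' /= [];
  try by move=> [[[p1 chi] q1] H /= [<- <- He]]; apply: rt_step; exists chi.
  by [].
move=> [i [x [p' [q' [H1 Hx H2 Hr]]]]].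
apply: (@rt_trans _ _ _ (p', u, (x, tnth u i) :: alpha)).
  by apply: rt_step; exists (Drop _ i x); split.
apply: (@rt_trans _ _ _ (q', u', (x, tnth u i) :: alpha)); last first.
  by apply: rt_step; exists (Retrieve _ _ x); split=> //; split=> //; exists (tnth u i).
have: forall c c', reach (macro n ((x, tnth u i) :: alpha)) c c' ->
  clos_refl_trans _ (@step _ _ _ A t) (c, (x, tnth u i) :: alpha) (c', (x, tnth u i) :: alpha).
  move=> c c'; elim=> {c c'} [[c1 c2] [c1' c2'] /= /IH //|c|a b c _ H _ H']; first exact: rt_refl.
  exact: rt_trans H H'.
by move/(_ _ _ Hr).
Qed.

(** On a stack without repetition this is the number of pebbles not in use, which bounds the nesting
    of further excursions. *)
Definition fuel alpha : nat := #|pebble A| - size alpha.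

(** A run observed in the middle has unfinished excursions, one for each pebble on the stack. This
    describes how they are completed from the top down, and so allows an induction along single
    steps. *)
Fixpoint unwinds alpha (c cf : state A * k.-tuple (node t)) : Prop :=
  if alpha is (x, w) :: alpha' then
    exists q1 u1 q2, [/\ reach (macro (fuel alpha) alpha) c (q1, u1),
      (q1, Retrieve _ _ x, q2) \in instructions A & unwinds alpha' (q2, u1) cf]
  else reach (macro (fuel [::]) [::]) c cf.

Lemma unwinds_macro alpha p q u u' cf :
  macro (fuel alpha) alpha p q u u' -> unwinds alpha (q, u') cf -> unwinds alpha (p, u) cf.
Proof.
case: alpha => [|[x w] alpha] H /=.
  by apply: rt_trans; apply: rt_step.
move=> [q1 [u1 [q2 [H1 H2 H3]]]]; exists q1, u1, q2; split=> //.
by apply: rt_trans H1; apply: rt_step.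
Qed.

(** Putting a step in front: a drop turns the topmost pending excursion into one macro step, a
    retrieve starts a new pending excursion, and any other step is itself a macro step. *)
Lemma unwinds_step p q u u' alpha alpha' cf :
  uniq (unzip1 alpha) -> step (p, u, alpha) (q, u', alpha') ->
  uniq (unzip1 alpha') /\ (unwinds alpha' (q, u') cf -> unwinds alpha (p, u) cf).
Proof.
move=> Hu [chi [Hin He]].
have Hlocal : alpha' = alpha ->
    uniq (unzip1 alpha') /\ (unwinds alpha' (q, u') cf -> unwinds alpha (p, u) cf).
  move=> E; subst alpha'; split=> //; apply: unwinds_macro.
  have Hl : exists2 i, i \in instructions A &
      [/\ i.1.1 = p, i.2 = q & exec i.1.2 u alpha u' alpha] by exists (p, chi, q).
  by case: (fuel alpha) => [|n]; left.
case: chi Hin He Hlocal => [i|i j|i x|x|tau|tau] Hin /= He Hlocal.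
- by case: He => E _; apply: Hlocal.
- by case: He => E _; apply: Hlocal.
- case: He => E [Hx E']; subst u' alpha' => {Hlocal}.
  have Hu' : uniq (unzip1 ((x, tnth u i) :: alpha)) by rewrite /= Hx.
  split=> // -[q1 [u1 [q2 [H1 H2 H3]]]]; apply: unwinds_macro H3.
  (* The longer stack is still without repetition, so the truncated subtraction is exact. *)
  have Hsize : fuel alpha = (fuel ((x, tnth u i) :: alpha)).+1.
    have := uniq_leq_size (s2 := enum (pebble A)) Hu' (fun y _ => etrans (mem_enum _ _) isT).
    by rewrite size_map -cardE /fuel /=; lia.
  by rewrite Hsize; right; exists i, x, q, q1.
- case: He => E [w E']; subst u' alpha => {Hlocal}.
  split; first by case/andP: Hu.
  by move=> H; exists p, u, q; split=> //; apply: rt_refl.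
- by case: He => [[_ E] _]; apply: Hlocal.
- by case: He => [[_ E] _]; apply: Hlocal.
Qed.

Lemma reach_macro p q u u' :
  clos_refl_trans _ (@step _ _ _ A t) (p, u, [::]) (q, u', [::]) <->
  reach (macro #|pebble A| [::]) (p, u) (q, u').
Proof.
split.
  have: forall c c', clos_refl_trans_1n _ (@step _ _ _ A t) c c' ->
    c' = (q, u', [::]) -> uniq (unzip1 c.2) -> unwinds c.2 c.1 (q, u').
    move=> c c'; elim=> {c c'} [c -> _|[[c1 c2] c3] [[d1 d2] d3] c' H _ IH E Hu] /=.
      exact: rt_refl.
    by have [Hu' Hun] := unwinds_step (q, u') Hu H; apply/Hun/IH.
  move=> H /clos_rt_rt1n_iff Hr; have := H _ _ Hr erefl isT.
  by rewrite /= /fuel subn0.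
move=> H; have: forall c c', reach (macro #|pebble A| [::]) c c' ->
  clos_refl_trans _ (@step _ _ _ A t) (c, [::]) (c', [::]).
  move=> c c'; elim=> {c c'} [[c1 c2] [c1' c2'] /= /macro_sound //|c|a b c _ H1 _ H2]; first exact: rt_refl.
  exact: rt_trans H1 H2.
by move/(_ _ _ H).
Qed.
End Correctness.
End MacroSteps.

(** * Definability of reachability, halting and acceptance *)

Section DefinableRuns.
Variables (Sigma : finType) (rank : Sigma -> nat) (k : nat) (hk : 0 < k).

Let h : 'I_k := Ordinal hk.
Local Notation predicate := (predicate rank).
Local Notation definable := (@definable Sigma rank k).
Local Notation rel_definable := (@rel_definable Sigma rank k).

Lemma definable_true (V : finType) (x : V) : definable (fun t (v : V -> node t) => True).
Proof.
apply: definable_ext (definable_not (definable_false rank k x)) => t v.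
by split=> // _ [].
Qed.

Lemma definable_if (V : finType) (x : V) (b : bool) (P : predicate V) :
  definable P -> definable (fun t v => b /\ P t v).
Proof.
move=> H; case: b; first by apply: definable_ext H => t v; split=> // -[].
by apply: definable_ext (definable_false rank k x) => t v; split=> // -[].
Qed.

Lemma definable_forall_seq (V : finType) (x : V) (J : eqType) (s : seq J) (P : J -> predicate V) :
  (forall j, definable (P j)) -> definable (fun t v => forall j, j \in s -> P j t v).
Proof.
move=> H; apply: definable_ext (definable_not
  (definable_exists_seq x (s := s) (fun j _ => definable_not (H j)))) => t v.
split=> [H' j Hj|H' [j Hj]]; last by apply; apply: H'.
by apply: NNPP => Hn; apply: H'; exists j.
Qed.

Lemma definable_exists_node (V : finType) (P : predicate (option V)) :
  definable P -> definable (fun t (v : V -> node t) => exists u, P t (fun o => oapp v u o)).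
Proof.
move=> H; apply: definable_ext (definable_not (definable_forall_node (definable_not H))) => t v.
split=> [H'|[u Hu] H']; last exact: H' u Hu.
by apply: NNPP => Hn; apply: H' => u Hu; apply: Hn; exists u.
Qed.

Lemma definable_child_number (V : finType) (x : V) j :
  definable (fun t v => child_number (v x) = j).
Proof.
case: j => [|j].
  by apply: definable_ext (definable_root rank k x) => t v; rewrite child_number0.
have H : definable (fun t (v : option V -> node t) => is_child j.+1 (v None) (v (Some x))).
  exact: definable_edge.
apply: definable_ext (definable_exists_node H) => t v /=.
split=> [[u /is_child_number//]|E].
case: (root_or_child (v x)) => [/child_number0|[u]]; rewrite E //.
by exists u.
Qed.

Lemma rel_definable_ext (V : finType) (R R' : tuple_rel rank k V) :
  (forall t v u u', R t v u u' <-> R' t v u u') -> rel_definable R -> rel_definable R'.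
Proof.
move=> H HR V' e f g; apply: definable_ext (HR V' e f g) => t v; exact: H.
Qed.

Lemma rel_definable_eq (V : finType) : rel_definable (fun t (v : V -> node t) u u' => u = u').
Proof.
move=> V' e f g.
apply: definable_ext (definable_forall_seq (f h) (enum 'I_k) (fun i => definable_eq rank k (f i) (g i))) => t v.
split=> [H|/(f_equal (fun u => tnth u)) E i _]; last by have := f_equal (fun w => w i) E; rewrite !tnth_mktuple.
by apply: eq_from_tnth => i; rewrite !tnth_mktuple; apply: H; rewrite mem_enum.
Qed.

Section Elimination.
Variables (V : finType) (S : finType).
Variable M : forall t : tree rank, (V -> node t) -> S -> S -> k.-tuple (node t) -> k.-tuple (node t) -> Prop.
Hypothesis M_def : forall p q, rel_definable (fun t v => M v p q).
Hypothesis M_fun : forall t (v : V -> node t) p q q' u u1 u2,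
  M v p q u u1 -> M v p q' u u2 -> q = q' /\ u1 = u2.

Lemma eliminate_definable l p q :
  uniq l -> rel_definable (fun t v => eliminate (M v) l p q).
Proof.
elim: l p q => [|r l IH] p q /=; first by move=> _; apply: M_def.
move=> /andP[Hr Hu] V' e f g; apply: definable_or; first exact: IH.
(* [uniq] yields that [r] is not in [l], so the loop is a first return and its closure is
   deterministic. *)
have Hloop := definable_dtc (IH r r Hu)
  (fun t v a b b' => eliminate_fun (@M_fun t v) Hr).
apply: (definable_exists_tuple (P := fun t (v : V' -> node t) w => exists w',
  [/\ eliminate (M (fun z => v (e z))) l p r [tuple v (f i) | i < k] w,
      clos_refl_trans _ (eliminate (M (fun z => v (e z))) l r r) w w' &
      eliminate (M (fun z => v (e z))) l r q w' [tuple v (g i) | i < k]])).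
apply: (definable_exists_tuple (P := fun t (v : V' + 'I_k -> node t) w' =>
  [/\ eliminate (M (fun z => v (inl (e z)))) l p r [tuple v (inl (f i)) | i < k] [tuple v (inr i) | i < k],
      clos_refl_trans _ (eliminate (M (fun z => v (inl (e z)))) l r r) [tuple v (inr i) | i < k] w' &
      eliminate (M (fun z => v (inl (e z)))) l r q w' [tuple v (inl (g i)) | i < k]])).
have H1 := IH p r Hu (V' + 'I_k + 'I_k)%type (fun z => inl (inl (e z))) (fun i => inl (inl (f i))) (fun i => inl (inr i)).
have H2 := Hloop (V' + 'I_k + 'I_k)%type (fun z => inl (inl (e z))) (fun i => inl (inr i)) inr.
have H3 := IH r q Hu (V' + 'I_k + 'I_k)%type (fun z => inl (inl (e z))) inr (fun i => inl (inl (g i))).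
by apply: definable_ext (definable_and H1 (definable_and H2 H3)) => t v; split=> [[? []]|[]].
Qed.

Lemma reach_definable p q :
  rel_definable (fun t v u u' => reach (M v) (p, u) (q, u')).
Proof.
have Hl s : s \in enum S by rewrite mem_enum.
apply: (rel_definable_ext (R := fun t v u u' => (p == q /\ u = u') \/ eliminate (M v) (enum S) p q u u')).
  by move=> t v u u'; rewrite (reach_eliminate _ _ _ _ _ Hl); split=> -[[/eqP]|]; tauto.
move=> V' e f g; apply: definable_or; last exact: eliminate_definable (enum_uniq S) _ _ _ _.
exact/(definable_if (f h))/(@rel_definable_eq V).
Qed.
End Elimination.

Section Automaton.
Variable A : automaton Sigma k.
Hypothesis Hdet : deterministic A.

(** The order [s] of the pebbles is built into the formula; only their positions are variables. *)
Definition pebbles_at (t : tree rank) (s : seq (pebble A)) (v : pebble A -> node t) : stack A t :=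
  [seq (x, v x) | x <- s].

Lemma unzip1_pebbles_at t s (v : pebble A -> node t) : unzip1 (pebbles_at s v) = s.
Proof. by rewrite /unzip1 -map_comp map_id. Qed.

Lemma pebbles_at_push (t : tree rank) s x (v : pebble A -> node t) w : x \notin s ->
  (x, w) :: pebbles_at s v = pebbles_at (x :: s) (fun z => if z == x then w else v z).
Proof.
move=> Hx; rewrite /pebbles_at /= eqxx; congr cons; apply/eq_in_map => y Hy.
by case: eqP => // E; rewrite -E Hy in Hx.
Qed.

Lemma eq_move_head (t : tree rank) (u u' : k.-tuple (node t)) i w :
  u' = move_head u i w <-> tnth u' i = w /\ forall j, j \in enum (predC1 i) -> tnth u' j = tnth u j.
Proof.
split=> [->|[H1 H2]].
  split=> [|j]; first by rewrite tnth_move_head eqxx.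
  by rewrite mem_enum !inE tnth_move_head => /negbTE ->.
apply: eq_from_tnth => j; rewrite tnth_move_head; case: eqP => [->//|/eqP ne].
by apply: H2; rewrite mem_enum.
Qed.

Lemma holds_definable s tau (V : finType) (e : pebble A -> V) (f : 'I_k -> V) :
  definable (fun t v => holds tau (mktuple (fun i => v (f i))) (pebbles_at s (fun z => v (e z)))).
Proof.
case: tau => [i a|i x|i j] /=.
- by apply: definable_ext (definable_label rank k a (f i)) => t v; rewrite tnth_mktuple.
- apply: definable_ext (definable_if (f h) (x \in s) (definable_eq rank k (e x) (f i))) => t v.
  rewrite tnth_mktuple; split=> [[Hx <-]|/mapP[y Hy [-> ->]]] //.
  exact: (map_f (fun x => (x, v (e x)))).
- by apply: definable_ext (definable_child_number (f i) j) => t v; rewrite tnth_mktuple.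
Qed.

Lemma exec_definable s chi :
  rel_definable (fun t (v : pebble A -> node t) u u' =>
    exec chi u (pebbles_at s v) u' (pebbles_at s v)).
Proof.
move=> V e f g; have Hsame (i : 'I_k) := definable_forall_seq (f h) (enum (predC1 i))
  (fun j => definable_eq rank k (g j) (f j)).
have Htest : definable (fun t v => [tuple v (g i) | i < k] = [tuple v (f i) | i < k]).
  exact: (@rel_definable_eq V _ id g f).
case: chi => [i|i j|i x|x|tau|tau] /=.
(* The child number is a constant of the edge formula, so a move up is a finite disjunction over the
   numbers up to [max_rank]. *)
- have Hup := definable_exists_seq (f h) (s := iota 0 (max_rank rank).+1)
    (fun j _ => definable_edge rank k j (g i) (f i)).
  apply: definable_ext (definable_and Hup (Hsame i)) => t v; split.
    move=> [[j _ Hj] H]; split=> //; exists (v (g i)), j; rewrite tnth_mktuple; split=> //.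
    by apply/eq_move_head; split=> [|l /H]; rewrite !tnth_mktuple.
  move=> [_ [w [j [Hj /eq_move_head[Hw H]]]]]; rewrite !tnth_mktuple in Hj Hw; subst w.
  split; last by move=> l /H; rewrite !tnth_mktuple.
  by exists j => //; rewrite mem_iota ltnS -(is_child_number Hj) child_number_le.
- apply: definable_ext (definable_and (definable_edge rank k j (f i) (g i)) (Hsame i)) => t v; split.
    move=> [Hj H]; split=> //; exists (v (g i)); rewrite tnth_mktuple; split=> //.
    by apply/eq_move_head; split=> [|l /H]; rewrite !tnth_mktuple.
  move=> [_ [w [Hj /eq_move_head[Hw H]]]]; rewrite !tnth_mktuple in Hj Hw; subst w.
  by split=> // l /H; rewrite !tnth_mktuple.
- apply: definable_ext (definable_false rank k (f h)) => t v; split=> // -[_ [_]].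
  by move/(f_equal size) => /=; lia.
- apply: definable_ext (definable_false rank k (f h)) => t v; split=> // -[_ [w]].
  by move/(f_equal size) => /=; lia.
- apply: definable_ext (definable_and Htest (holds_definable s tau e f)) => t v; tauto.
- apply: definable_ext (definable_and Htest (definable_not (holds_definable s tau e f))) => t v; tauto.
Qed.

Lemma local_definable s p q :
  rel_definable (fun t (v : pebble A -> node t) u u' =>
    exists2 i, i \in instructions A &
    [/\ i.1.1 = p, i.2 = q & exec i.1.2 u (pebbles_at s v) u' (pebbles_at s v)]).
Proof.
move=> V e f g; apply: (definable_exists_seq (f h)) => i _.
apply: definable_ext (definable_if (f h) ((i.1.1 == p) && (i.2 == q)) (exec_definable s i.1.2 e f g)) => t v.
by split=> [[/andP[/eqP ? /eqP ?] ?]|[-> -> ?]]; rewrite ?eqxx.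
Qed.

Lemma macro_definable n s p q :
  rel_definable (fun t (v : pebble A -> node t) => macro n (pebbles_at s v) p q).
Proof.
elim: n s p q => [|n IH] s p q V e f g /=.
  by apply: definable_or; [exact: local_definable|exact: definable_false (f h)].
apply: definable_or; first exact: local_definable.
(* All possible excursions: the head and the pebble of the drop, the state after the drop, and the
   state before the retrieve. *)
pose js := [seq j : 'I_k * pebble A * state A * state A <- enum {: 'I_k * pebble A * state A * state A} |
  [&& (p, Drop _ j.1.1.1 j.1.1.2, j.1.2) \in instructions A, j.1.1.2 \notin s &
      (j.2, Retrieve _ _ j.1.1.2, q) \in instructions A]].
have Hreach x p' q' := reach_definable (IH (x :: s)) (fun t v => @macro_fun _ _ _ _ _ Hdet n _) p' q'.
have Hjs j (_ : j \in js) := Hreach j.1.1.2 j.1.2 j.2 V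
  (fun z => if z == j.1.1.2 then f j.1.1.1 else e z) f g.
apply: definable_ext (definable_exists_seq (f h) Hjs) => t v.
have Hpush x i : x \notin s -> 
  pebbles_at (x :: s) (fun z => v (if z == x then f i else e z)) =
  (x, v (f i)) :: pebbles_at s (fun z => v (e z)).
  move=> Hx; rewrite pebbles_at_push //; congr (pebbles_at _ _).
  by apply: functional_extensionality => z; case: ifP.
split.
  move=> [j]; rewrite mem_filter => /andP[/and3P[H1 Hx H2] _].
  rewrite (Hpush _ _ Hx) => Hr; exists j.1.1.1, j.1.1.2, j.1.2, j.2.
  by rewrite unzip1_pebbles_at tnth_mktuple.
move=> [i [x [p' [q' [H1 Hx H2 Hr]]]]]; rewrite unzip1_pebbles_at in Hx.
exists (i, x, p', q'); first by rewrite mem_filter /= H1 Hx H2 mem_enum.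
by rewrite tnth_mktuple -(Hpush x i Hx) in Hr.
Qed.

Lemma halting_definable p :
  definable (fun t (v : unit -> node t) =>
    @halting _ _ _ A t (p, mktuple (fun=> v tt), [::])).
Proof.
pose js := [seq i <- instructions A | i.1.1 == p].
pose enabled (chi : operation Sigma k (pebble A)) (t : tree rank) (v : unit -> node t) :=
  exists u' alpha', @exec _ _ _ A t chi (mktuple (fun=> v tt)) [::] u' alpha'.
have Hstep chi : definable (V := unit) (enabled chi).
  have Hloc : definable (fun t (v : unit -> node t) => exists u',
      @exec _ _ _ A t chi (mktuple (fun=> v tt)) [::] u' [::]).
    apply: definable_exists_tuple.
    exact: (exec_definable [::] chi (fun=> inl tt : unit + 'I_k) (fun=> inl tt) inr).
  (* On the empty stack a retrieve is never enabled, a drop always is, and every other operation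
     keeps the stack empty. *)
  case: chi Hloc => [i|i j|i x|x|tau|tau] Hloc; last 3 first.
  - apply: definable_ext (definable_false rank k tt) => t v; split=> //.
    by move=> [u' [alpha' [_ [w]]]].
  - by apply: definable_ext Hloc => t v; split=> [[u' H]|[u' [a [[H1 H2] H3]]]]; [exists u', [::]|exists u'].
  - by apply: definable_ext Hloc => t v; split=> [[u' H]|[u' [a [[H1 H2] H3]]]]; [exists u', [::]|exists u'].
  - by apply: definable_ext Hloc => t v; split=> [[u' H]|[u' [a [H1 H2]]]]; [exists u', [::]|exists u'].
  - by apply: definable_ext Hloc => t v; split=> [[u' H]|[u' [a [H1 H2]]]]; [exists u', [::]|exists u'].
  - apply: definable_ext (definable_true tt) => t v; split=> // _.
    by exists (mktuple (fun=> v tt)), [:: (x, tnth (mktuple (fun=> v tt)) i)].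
apply: definable_ext (definable_forall_seq tt js (fun i => definable_not (Hstep i.1.2))) => t v.
split=> [H [[q u'] alpha'] [chi [Hin He]]|H [[p' chi] q]].
  by case: (H (p, chi, q)); [rewrite mem_filter eqxx|exists u', alpha'].
rewrite mem_filter /= => /andP[/eqP -> Hin] [u' [alpha' He]].
by apply: (H (q, u', alpha')); exists chi.
Qed.

(** A single variable stands for the root and gives the position of all heads; the premise fixes its
    value. *)
Lemma acceptance_definable :
  definable (fun t (v : unit -> node t) => v tt = tree_root t -> accepts A t).
Proof.
have Hroot := definable_root rank k tt.
have Hreach p : definable (fun t (v : unit -> node t) =>
    reach (macro (A := A) #|pebble A| [::]) (init A, mktuple (fun=> v tt)) (p, mktuple (fun=> v tt))).
  exact: (reach_definable (macro_definable #|pebble A| [::])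
    (fun t v => @macro_fun _ _ _ _ _ Hdet _ _) (init A) p (fun=> tt) (fun=> tt) (fun=> tt)).
have Hacc := definable_exists_seq tt (s := enum (accepting A))
  (fun p _ => definable_and (Hreach p) (halting_definable p)).
apply: definable_ext (definable_not (definable_and Hroot (definable_not Hacc))) => t v.
have Eu : v tt = tree_root t -> mktuple (fun=> v tt) = nseq_tuple k (tree_root t).
  by move=> E; apply: eq_from_tnth => i; rewrite tnth_mktuple tnth_nseq.
split=> [H E|H [E]]; last first.
  apply; case: (H E) => p [Hp Hrun Hhalt]; exists p; first by rewrite mem_enum.
  by rewrite Eu //; split=> //; apply/reach_macro.
have /NNPP[p Hp] := fun Hn => H (conj E Hn).
rewrite Eu // => -[Hr Hhalt]; exists p; split=> //; first by rewrite mem_enum in Hp.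
exact/reach_macro.
Qed.

End Automaton.
End DefinableRuns.

Theorem formula_of_automaton (Sigma : finType) (rank : Sigma -> nat) (k : nat)
    (hk : 0 < k) (A : automaton Sigma k) : deterministic A ->
  exists phi : formula Sigma k, [/\ is_FO_DTC rank phi, closed_formula phi &
    forall t : tree rank, models t phi <-> accepts A t].
Proof.
move=> Hdet; have [phi [H1 H2]] := acceptance_definable rank hk Hdet (fun=> 0).
(* [models] ranges over all valuations, so the universal closure has the same models as [phi]; the
   valuation constantly at the root satisfies the premise of [acceptance_definable]. *)
exists (foldr (@FAll _ _) phi (free_vars phi)); split.
- by elim: (free_vars phi).
- rewrite /closed_formula.
  have -> l : free_vars (foldr (@FAll _ _) phi l) = [seq z <- free_vars phi | z \notin l].
    elim: l => [|x l IH] /=; first by rewrite filter_predT.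
    by rewrite IH -filter_predI; apply: eq_filter => z /=; rewrite in_cons negb_or.
  by rewrite -(filter_pred0 (free_vars phi)); apply/eqP/eq_in_filter => z ->.
move=> t; have -> l : models t (foldr (@FAll _ _) phi l) <-> models t phi.
  elim: l => //= x l <-; split=> H v; last by move=> u; apply: H.
  have := H v (v x); rewrite (_ : update v x (v x) = v) //.
  by apply: functional_extensionality => z; rewrite /update; case: eqP => [->|].
by split=> [H|H v]; [exact: (H2 t (fun=> tree_root t)).1 | apply/H2].
Qed.

Theorem theorem5p3 (Sigma : finType) (rank : Sigma -> nat) (k : nat)
    (hk : 1 <= k) (L : tree rank -> Prop) :
  (exists A : automaton Sigma k,
     deterministic A /\ forall t : tree rank, L t <-> accepts A t) <->
  (exists phi : formula Sigma k,
     [/\ is_FO_DTC rank phi, closed_formula phi &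
         forall t : tree rank, L t <-> models t phi]).
Proof.
split=> [[A [Hdet HA]]|[phi [H1 H2 H3]]].
  have [phi [H1 H2 H3]] := formula_of_automaton rank hk Hdet.
  by exists phi; split=> // t; rewrite HA H3.
have [A [Hdet HA]] := automaton_of_formula hk H1 H2.
by exists A; split=> // t; rewrite H3 HA.
Qed.
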